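(* Let $X$ be a separable Tychonoff space. Then $A(X)$ is a $k$-space with a $\mathfrak{G}$-base if and only if $X$ is either countable and discrete or a submetrizable $k_{\omega}$-space. *)

(* Defs.v *)
From Stdlib Require Import Reals ZArith List Classical ClassicalEpsilon
  FunctionalExtensionality ProofIrrelevance.
Open Scope R_scope.

Definition is_topology {X : Type} (op : (X -> Prop) -> Prop) : Prop :=
  op (fun _ => True) /\
  (forall U V, op U -> op V -> op (fun x => U x /\ V x)) /\
  (forall F : (X -> Prop) -> Prop, (forall U, F U -> op U) ->
     op (fun x => exists U, F U /\ U x)).

Definition continuous {X Y : Type} (opX : (X -> Prop) -> Prop)
  (opY : (Y -> Prop) -> Prop) (f : X -> Y) : Prop :=
  forall V, opY V -> opX (fun x => V (f x)).

Definition is_metric {X : Type} (d : X -> X -> R) : Prop :=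
  (forall x y, 0 <= d x y) /\ (forall x y, d x y = 0 <-> x = y) /\
  (forall x y, d x y = d y x) /\ (forall x y z, d x z <= d x y + d y z).

Definition metric_open {X : Type} (d : X -> X -> R) (U : X -> Prop) : Prop :=
  forall x, U x -> exists e, 0 < e /\ forall y, d x y < e -> U y.

Definition R_open : (R -> Prop) -> Prop := metric_open (fun a b => Rabs (a - b)).

Definition T1 {X : Type} (op : (X -> Prop) -> Prop) : Prop :=
  forall x y : X, x <> y -> exists U, op U /\ U x /\ ~ U y.

Definition completely_regular {X : Type} (op : (X -> Prop) -> Prop) : Prop :=
  forall (F : X -> Prop) (x : X), op (fun y => ~ F y) -> ~ F x ->
    exists f : X -> R, continuous op R_open f /\ f x = 0 /\
      (forall y, F y -> f y = 1) /\ (forall y, 0 <= f y <= 1).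

Definition tychonoff {X : Type} (op : (X -> Prop) -> Prop) : Prop :=
  T1 op /\ completely_regular op.

Definition countable_set {X : Type} (D : X -> Prop) : Prop :=
  exists g : nat -> X, forall x, D x -> exists n, g n = x.

Definition countable_type (X : Type) : Prop := countable_set (fun _ : X => True).

Definition dense {X : Type} (op : (X -> Prop) -> Prop) (D : X -> Prop) : Prop :=
  forall U, op U -> (exists x, U x) -> exists x, U x /\ D x.

Definition separable {X : Type} (op : (X -> Prop) -> Prop) : Prop :=
  exists D, countable_set D /\ dense op D.

Definition discrete {X : Type} (op : (X -> Prop) -> Prop) : Prop :=
  forall U : X -> Prop, op U.

Definition compact {X : Type} (op : (X -> Prop) -> Prop) (K : X -> Prop) : Prop :=
  forall F : (X -> Prop) -> Prop, (forall U, F U -> op U) ->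
    (forall x, K x -> exists U, F U /\ U x) ->
    exists l : list (X -> Prop), (forall U, In U l -> F U) /\
      (forall x, K x -> exists U, In U l /\ U x).

Definition rel_open {X : Type} (op : (X -> Prop) -> Prop) (K W : X -> Prop) : Prop :=
  exists V, op V /\ forall x, K x -> (W x <-> V x).

Definition kspace {X : Type} (op : (X -> Prop) -> Prop) : Prop :=
  forall U : X -> Prop, (forall K, compact op K -> rel_open op K U) -> op U.

Definition k_omega {X : Type} (op : (X -> Prop) -> Prop) : Prop :=
  exists Kn : nat -> X -> Prop,
    (forall n, compact op (Kn n)) /\
    (forall n x, Kn n x -> Kn (S n) x) /\
    (forall x, exists n, Kn n x) /\
    (forall U, (forall n, rel_open op (Kn n) U) -> op U).

Definition submetrizable {X : Type} (op : (X -> Prop) -> Prop) : Prop :=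
  exists d : X -> X -> R, is_metric d /\ forall U, metric_open d U -> op U.

Definition Gbase_at {X : Type} (op : (X -> Prop) -> Prop) (x : X) : Prop :=
  exists U : (nat -> nat) -> X -> Prop,
    (forall a, exists V, op V /\ V x /\ forall y, V y -> U a y) /\
    (forall V, op V -> V x -> exists a, forall y, U a y -> V y) /\
    (forall a b : nat -> nat, (forall n, (a n <= b n)%nat) ->
       forall y, U b y -> U a y).

Definition has_Gbase {X : Type} (op : (X -> Prop) -> Prop) : Prop :=
  forall x, Gbase_at op x.

Definition finsupp {X : Type} (f : X -> Z) : Prop :=
  exists l : list X, forall x, f x <> 0%Z -> In x l.

Definition FA (X : Type) : Type := { f : X -> Z | finsupp f }.

Lemma finsupp_add {X : Type} (f g : X -> Z) :
  finsupp f -> finsupp g -> finsupp (fun x => (f x + g x)%Z).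
Proof.
  intros [l1 H1] [l2 H2]; exists (l1 ++ l2); intros x Hx; apply in_or_app.
  destruct (Z.eq_dec (f x) 0) as [E|E].
  - right; apply H2; intro E'; apply Hx; rewrite E, E'; reflexivity.
  - left; apply H1; exact E.
Qed.

Lemma finsupp_opp {X : Type} (f : X -> Z) :
  finsupp f -> finsupp (fun x => (- f x)%Z).
Proof.
  intros [l H]; exists l; intros x Hx; apply H; intro E; apply Hx; rewrite E;
  reflexivity.
Qed.

Definition FA_add {X : Type} (a b : FA X) : FA X :=
  exist _ (fun x => (proj1_sig a x + proj1_sig b x)%Z)
    (finsupp_add _ _ (proj2_sig a) (proj2_sig b)).

Definition FA_opp {X : Type} (a : FA X) : FA X :=
  exist _ (fun x => (- proj1_sig a x)%Z) (finsupp_opp _ (proj2_sig a)).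

Definition delta {X : Type} (x : X) : X -> Z :=
  fun y => if excluded_middle_informative (y = x) then 1%Z else 0%Z.

Lemma finsupp_delta {X : Type} (x : X) : finsupp (delta x).
Proof.
  exists (x :: nil); intros y Hy; unfold delta in Hy.
  destruct (excluded_middle_informative (y = x)) as [E|E].
  - left; symmetry; exact E.
  - exfalso; apply Hy; reflexivity.
Qed.

Definition eta {X : Type} (x : X) : FA X := exist _ (delta x) (finsupp_delta x).

Definition group_topology {X : Type} (sg : (FA X -> Prop) -> Prop) : Prop :=
  is_topology sg /\
  (forall W, sg W -> forall a b, W (FA_add a b) ->
     exists U V, sg U /\ sg V /\ U a /\ V b /\
       forall u v, U u -> V v -> W (FA_add u v)) /\
  (forall W, sg W -> sg (fun a => W (FA_opp a))).

Definition admissible {X : Type} (op : (X -> Prop) -> Prop)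
  (sg : (FA X -> Prop) -> Prop) : Prop :=
  group_topology sg /\ continuous op sg eta.

(** Markov's free abelian topological group A(X): the finest admissible group
    topology, i.e. the union of all admissible group topologies (this union is
    itself an admissible group topology, namely their supremum). *)
Definition A_open {X : Type} (op : (X -> Prop) -> Prop) : (FA X -> Prop) -> Prop :=
  fun U => exists sg, admissible op sg /\ sg U.

(* Main.v *)
(** Topology on A(X) is handled through its neighborhoods of 0, and compactness through ideals
    of sets: K is compact iff every ideal of sets that is locally present on K contains K.

    If X is a k_omega-space exhausted by compact sets K_n and d is a continuous metric, the sets
    of all finite sums of differences x_i - y_i with x_i, y_i in K_i and
    d(x_i, y_i) <= 1/(a(i) + 1), for a in N^N, form a base at 0. The k-property follows by
    choosing a(0), a(1), ... successively: the compact set of sums obtained so far stays inside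
    the given k-open set when sufficiently short differences from the next K_n are added.

    Conversely let A(X) be a k-space with a G-base (U_a) at 0. The sets of [0,1]-valued functions
    with a common modulus of continuity measured by the G-base, together with a countable dense
    subset of X, give countably many continuous functions that separate the points of A(X), so
    that A(X) is submetrizable. For a finite sequence t let D_t be the intersection of the U_b
    with b extending t. Each compact set meets some D_t, t an initial segment of a, in a relative
    neighborhood of 0. If X is not discrete it contains a nontrivial convergent sequence p_m -> s.
    If a compact set admitted no relative neighborhood of 0 contained in a relatively compact
    finite intersection of sets D_t, there would be rows y(i, .), converging to 0 uniformly as
    i grows, each leaving every compact set; then the nonzero elements y(i, m) + i (p_m - s) form
    a set that meets each compact set in a finite set but has 0 in its closure, against the
    k-property. Hence the countably many relatively compact finite intersections generate an
    open sigma-compact submonoid, and its translates by a countable dense set trace a k_omega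
    exhaustion on X. *)

From Stdlib Require Import Reals ZArith List Classical ClassicalEpsilon.
From Stdlib Require Import Lra Lia FunctionalExtensionality PropExtensionality
  ProofIrrelevance Arith Permutation Cantor.
(* Imported last: [compact] must denote the notion of Defs, not that of Rtopology. *)
Require Import Defs.

(** * Neighborhoods and compactness *)

Lemma set_ext {X : Type} (U V : X -> Prop) : (forall x, U x <-> V x) -> U = V.
Proof.
  intro H; apply functional_extensionality; intro x.
  apply propositional_extensionality; apply H.
Qed.

Definition nbhd {X : Type} (op : (X -> Prop) -> Prop) (x : X) (N : X -> Prop) : Prop :=
  exists V, op V /\ V x /\ forall y, V y -> N y.

Lemma nbhd_self {X : Type} (op : (X -> Prop) -> Prop) x N : nbhd op x N -> N x.
Proof. intros (V & _ & Hx & H); auto. Qed.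

Lemma nbhd_open {X : Type} (op : (X -> Prop) -> Prop) x U : op U -> U x -> nbhd op x U.
Proof. intros H Hx; exists U; auto. Qed.

Lemma nbhd_mono {X : Type} (op : (X -> Prop) -> Prop) x (N M : X -> Prop) :
  nbhd op x N -> (forall y, N y -> M y) -> nbhd op x M.
Proof. intros (V & HV & Hx & H) HM; exists V; auto. Qed.

Lemma nbhd_and {X : Type} (op : (X -> Prop) -> Prop) x (N M : X -> Prop) :
  is_topology op -> nbhd op x N -> nbhd op x M -> nbhd op x (fun y => N y /\ M y).
Proof.
  intros (_ & HI & _) (V & HV & Vx & H) (W & HW & Wx & H').
  exists (fun y => V y /\ W y); repeat split; try apply HI; firstorder.
Qed.

Lemma nbhd_true {X : Type} (op : (X -> Prop) -> Prop) x :
  is_topology op -> nbhd op x (fun _ => True).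
Proof. intros (H & _); exists (fun _ => True); auto. Qed.

Lemma nbhd_interior {X : Type} (op : (X -> Prop) -> Prop) x N :
  nbhd op x N -> nbhd op x (fun y => nbhd op y N).
Proof. intros (V & HV & Vx & H); exists V; repeat split; auto; intros y Vy; exists V; auto. Qed.

Lemma open_of_nbhd {X : Type} (op : (X -> Prop) -> Prop) (U : X -> Prop) :
  is_topology op -> (forall x, U x -> nbhd op x U) -> op U.
Proof.
  intros (_ & _ & HU) H.
  rewrite (set_ext U (fun x => exists V, (op V /\ forall y, V y -> U y) /\ V x)).
  - apply HU; tauto.
  - intro x; split.
    + intro Ux; destruct (H x Ux) as (V & HV & Vx & Hs); exists V; auto.
    + intros (V & (_ & Hs) & Vx); auto.
Qed.

Lemma rel_open_of_nbhd {X : Type} (op : (X -> Prop) -> Prop) (K W : X -> Prop) :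
  is_topology op -> (forall x, K x -> W x -> nbhd op x (fun y => K y -> W y)) ->
  rel_open op K W.
Proof.
  intros Ht H.
  exists (fun x => nbhd op x (fun y => K y -> W y)); split.
  - apply open_of_nbhd; auto; intros x; apply nbhd_interior.
  - intros x Kx; split; auto; intro Hn; exact (nbhd_self _ _ _ Hn Kx).
Qed.

Lemma rel_open_nbhd {X : Type} (op : (X -> Prop) -> Prop) (K W : X -> Prop) x :
  rel_open op K W -> K x -> W x -> nbhd op x (fun y => K y -> W y).
Proof.
  intros (V & HV & H) Kx Wx; exists V; repeat split; auto.
  - apply H; auto.
  - intros y Vy Ky; apply H; auto.
Qed.

Lemma continuous_nbhd {X Y : Type} (opX : (X -> Prop) -> Prop) (opY : (Y -> Prop) -> Prop)
  (f : X -> Y) x N :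
  continuous opX opY f -> nbhd opY (f x) N -> nbhd opX x (fun y => N (f y)).
Proof.
  intros Hf (V & HV & Vx & H); exists (fun y => V (f y)); repeat split; auto.
Qed.

(** The product topology. Boxes are made of neighborhoods instead of open sets, so that facts about
    [nbhd] apply to the factors directly. *)
Definition prod_open {X Y : Type} (opX : (X -> Prop) -> Prop) (opY : (Y -> Prop) -> Prop)
  (W : X * Y -> Prop) : Prop :=
  forall p, W p -> exists A B, nbhd opX (fst p) A /\ nbhd opY (snd p) B /\
    forall x y, A x -> B y -> W (x, y).

Lemma nbhd_prod {X Y : Type} (opX : (X -> Prop) -> Prop) (opY : (Y -> Prop) -> Prop) x y A B :
  nbhd opX x A -> nbhd opY y B ->
  nbhd (prod_open opX opY) (x, y) (fun p => A (fst p) /\ B (snd p)).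
Proof.
  intros (V & HV & Vx & H) (W & HW & Wy & H').
  exists (fun p => V (fst p) /\ W (snd p)); repeat split; simpl; auto.
  - intros [u v] [Hu Hv]; exists V, W; repeat split; simpl in *; auto.
    + apply nbhd_open; auto.
    + apply nbhd_open; auto.
  - apply H; tauto.
  - apply H'; tauto.
Qed.

Definition ideal {X : Type} (P : (X -> Prop) -> Prop) : Prop :=
  P (fun _ => False) /\
  (forall A B, P A -> P B -> P (fun x => A x \/ B x)) /\
  (forall A B : X -> Prop, (forall x, A x -> B x) -> P B -> P A).

(** Induction over a compact set: the open sets whose trace on [K] lies in [P] cover [K], and the
    union of a finite subcover stays in the ideal. *)
Lemma compact_ind {X : Type} (op : (X -> Prop) -> Prop) (K : X -> Prop)
  (P : (X -> Prop) -> Prop) :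
  compact op K -> ideal P ->
  (forall x, K x -> exists N, nbhd op x N /\ P (fun y => N y /\ K y)) -> P K.
Proof.
  intros HK (H0 & HU & HM) Hloc.
  destruct (HK (fun U => op U /\ P (fun y => U y /\ K y))) as (l & Hl & Hc).
  - tauto.
  - intros x Kx; destruct (Hloc x Kx) as (N & (V & HV & Vx & HVN) & HP).
    exists V; repeat split; auto; apply (HM _ (fun y => N y /\ K y)); firstorder.
  - apply (HM _ (fun x => exists U, In U l /\ U x /\ K x)).
    { intros x Kx; destruct (Hc x Kx) as (U & ? & ?); eauto. }
    clear Hc; induction l as [|U l IH].
    + apply (HM _ (fun _ => False)); auto; intros x (U & [] & _).
    + apply (HM _ (fun x => (U x /\ K x) \/ exists U, In U l /\ U x /\ K x)).
      * intros x (U' & [->|Hin] & ?); eauto.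
      * apply HU; [apply Hl; left; auto | apply IH; intros; apply Hl; right; auto].
Qed.

(** Converse of [compact_ind]: given an open cover, the sets covered by finitely many of its members
    form an ideal that is locally present on [K]. *)
Lemma compact_of_ideals {X : Type} (op : (X -> Prop) -> Prop) (K : X -> Prop) :
  (forall P, ideal P -> (forall x, K x -> exists N, nbhd op x N /\ P N) -> P K) ->
  compact op K.
Proof.
  intros H F HF Hc.
  apply (H (fun A => exists l : list (X -> Prop), (forall U, In U l -> F U) /\
      forall x, A x -> exists U, In U l /\ U x)).
  - split; [|split].
    + exists nil; simpl; firstorder.
    + intros A B (l & Hl & HA) (l' & Hl' & HB); exists (l ++ l'); split.
      * intros U HU; apply in_app_or in HU; firstorder.
      * intros x [Hx|Hx]; [destruct (HA x Hx) as (U & ? & ?)|destruct (HB x Hx) as (U & ? & ?)];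
          exists U; split; auto; apply in_or_app; auto.
    + intros A B HAB (l & Hl & HB); exists l; auto.
  - intros x Kx; destruct (Hc x Kx) as (U & HU & Ux); exists U; split.
    + apply nbhd_open; auto.
    + exists (U :: nil); split.
      * intros U' [<-|[]]; auto.
      * intros y Uy; exists U; simpl; auto.
Qed.

Lemma compact_image {X Y : Type} (opX : (X -> Prop) -> Prop) (opY : (Y -> Prop) -> Prop)
  (f : X -> Y) K :
  continuous opX opY f -> compact opX K -> compact opY (fun y => exists x, K x /\ y = f x).
Proof.
  intros Hf HK; apply compact_of_ideals; intros P HP Hloc.
  apply (compact_ind opX K (fun A => P (fun y => exists x, A x /\ y = f x))); auto.
  - destruct HP as (H0 & HU & HM); split; [|split].
    + apply (HM _ _ (fun y (H : exists x, False /\ y = f x) =>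
        match H with ex_intro _ _ (conj a _) => a end) H0).
    + intros A B HA HB; refine (HM _ _ _ (HU _ _ HA HB)); intros y (x & [?|?] & ?); eauto.
    + intros A B HAB; apply HM; intros y (x & ? & ?); eauto.
  - intros x Kx; destruct (Hloc (f x)) as (N & HN & PN); eauto.
    exists (fun y => N (f y)); split.
    + apply (continuous_nbhd opX opY); auto.
    + refine (proj2 (proj2 HP) _ _ _ PN); intros y (x' & (? & _) & ->); auto.
Qed.

(** The tube lemma as two nested inductions: for fixed [x], the inner one over [L] finds a
    neighborhood [N] of [x] with [N] times [L] in the ideal; the outer one runs over [K]. *)
Lemma compact_prod {X Y : Type} (opX : (X -> Prop) -> Prop) (opY : (Y -> Prop) -> Prop) K L :
  is_topology opX -> compact opX K -> compact opY L ->
  compact (prod_open opX opY) (fun p => K (fst p) /\ L (snd p)).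
Proof.
  intros Ht HK HL; apply compact_of_ideals; intros P HP Hloc.
  pose proof HP as (H0 & HU & HM).
  apply (compact_ind opX K (fun A => P (fun p => A (fst p) /\ L (snd p)))); auto.
  - split; [|split].
    + apply (HM _ (fun _ => False)); tauto.
    + intros A B HA HB; refine (HM _ _ _ (HU _ _ HA HB)); tauto.
    + intros A B HAB; apply HM; firstorder.
  - intros x Kx.
    assert (exists N, nbhd opX x N /\ P (fun p => N (fst p) /\ L (snd p))) as (N & HN & PN).
    { apply (compact_ind opY L
        (fun B => exists N, nbhd opX x N /\ P (fun p => N (fst p) /\ B (snd p)))); auto.
      - split; [|split].
        + exists (fun _ => True); split; [apply nbhd_true; auto|].
          apply (HM _ (fun _ => False)); tauto.
        + intros A B (N & HN & PN) (M & HM' & PM); exists (fun x => N x /\ M x); split.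
          * apply nbhd_and; auto.
          * refine (HM _ _ _ (HU _ _ PN PM)); tauto.
        + intros A B HAB (N & HN & PN); exists N; split; auto.
          refine (HM _ _ _ PN); firstorder.
      - intros y Ly; destruct (Hloc (x, y)) as (W & (V & HV & Vxy & HVW) & PW); [simpl; auto|].
        destruct (HV _ Vxy) as (A & B & HA & HB & HAB).
        exists B; split; auto; exists A; split; auto.
        refine (HM _ _ _ PW); intros [u v]; simpl; intros (? & ? & _); auto. }
    exists N; split; auto; refine (HM _ _ _ PN); firstorder.
Qed.

Lemma compact_inter_closed {X : Type} (op : (X -> Prop) -> Prop) K (C : X -> Prop) :
  compact op K -> op (fun x => ~ C x) -> compact op (fun x => K x /\ C x).
Proof.
  intros HK HC; apply compact_of_ideals; intros P HP Hloc.
  pose proof HP as (H0 & HU & HM).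
  apply (compact_ind op K (fun A => P (fun x => A x /\ C x))) in HK.
  - exact HK.
  - split; [|split].
    + apply (HM _ (fun _ => False)); tauto.
    + intros A B HA HB; refine (HM _ _ _ (HU _ _ HA HB)); tauto.
    + intros A B HAB; apply HM; firstorder.
  - intros x Kx; destruct (classic (C x)) as [Cx|nCx].
    + destruct (Hloc x) as (N & HN & PN); auto.
      exists N; split; auto; refine (HM _ _ _ PN); tauto.
    + exists (fun x => ~ C x); split; [apply nbhd_open; auto|].
      apply (HM _ (fun _ => False)); tauto.
Qed.

Lemma compact_union {X : Type} (op : (X -> Prop) -> Prop) K L :
  compact op K -> compact op L -> compact op (fun x => K x \/ L x).
Proof.
  intros HK HL; apply compact_of_ideals; intros P HP Hloc.
  pose proof HP as (H0 & HU & HM).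
  apply HU.
  - apply (compact_ind op K); auto; intros x Kx; destruct (Hloc x) as (N & ? & PN); auto.
    exists N; split; auto; refine (HM _ _ _ PN); tauto.
  - apply (compact_ind op L); auto; intros x Kx; destruct (Hloc x) as (N & ? & PN); auto.
    exists N; split; auto; refine (HM _ _ _ PN); tauto.
Qed.

Lemma compact_empty {X : Type} (op : (X -> Prop) -> Prop) : compact op (fun _ => False).
Proof. apply compact_of_ideals; intros P HP _; apply HP. Qed.

Lemma compact_point {X : Type} (op : (X -> Prop) -> Prop) (x : X) :
  compact op (fun y => y = x).
Proof.
  apply compact_of_ideals; intros P (_ & _ & HM) Hloc.
  destruct (Hloc x eq_refl) as (N & HN & PN); apply (HM _ N); auto.
  intros y ->; exact (nbhd_self _ _ _ HN).
Qed.

Lemma compact_sequence {X : Type} (op : (X -> Prop) -> Prop) (x : nat -> X) (c : X) :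
  (forall N, nbhd op c N -> exists M, forall n, (M <= n)%nat -> N (x n)) ->
  compact op (fun y => y = c \/ exists n, y = x n).
Proof.
  intro Hlim; apply compact_of_ideals; intros P (H0 & HU & HM) Hloc.
  destruct (Hloc c) as (N & HN & PN); auto.
  destruct (Hlim N HN) as (M & HMn).
  assert (HF : forall m, P (fun y => exists n, (n < m)%nat /\ y = x n)).
  { induction m as [|m IH].
    - apply (HM _ (fun _ => False)); auto; intros y (n & ? & _); lia.
    - destruct (Hloc (x m)) as (N' & HN' & PN'); eauto.
      refine (HM _ _ _ (HU _ _ IH PN')); intros y (n & Hn & ->).
      destruct (Nat.eq_dec n m) as [->|]; [right; exact (nbhd_self _ _ _ HN')|].
      left; exists n; split; auto; lia. }
  refine (HM _ _ _ (HU _ _ PN (HF M))); intros y [->|(n & ->)].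
  - left; exact (nbhd_self _ _ _ HN).
  - destruct (le_lt_dec M n); eauto.
Qed.

(** * Cluster points and relative compactness *)

Definition cluster {X : Type} (op : (X -> Prop) -> Prop) (x : nat -> X) (c : X) : Prop :=
  forall N, nbhd op c N -> forall M, exists n, (M <= n)%nat /\ N (x n).

(** The sets that the sequence eventually avoids form an ideal. Without a cluster point in [K] this
    ideal would be locally present on [K], hence contain it. *)
Lemma compact_cluster {X : Type} (op : (X -> Prop) -> Prop) K (x : nat -> X) :
  compact op K -> (forall M, exists n, (M <= n)%nat /\ K (x n)) ->
  exists c, K c /\ cluster op x c.
Proof.
  intros HK Hinf; apply NNPP; intro Hno.
  assert (exists M, forall n, (M <= n)%nat -> ~ K (x n)) as (M & HM).
  { apply (compact_ind op K (fun A => exists M, forall n, (M <= n)%nat -> ~ A (x n))); auto.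
    - split; [|split].
      + exists O; auto.
      + intros A B (M & HA) (M' & HB); exists (Nat.max M M'); intros n Hn [?|?].
        * apply (HA n); auto; lia.
        * apply (HB n); auto; lia.
      + intros A B HAB (M & HB); exists M; intros n Hn HA; apply (HB n); auto.
    - intros c Kc; apply NNPP; intro H; apply Hno; exists c; split; auto.
      intros N HN M; apply NNPP; intro H'; apply H; exists N; split; auto.
      exists M; intros n Hn (? & _); apply H'; eauto. }
  destruct (Hinf M) as (n & ? & ?); firstorder.
Qed.

Lemma compact_bounded {X : Type} (op : (X -> Prop) -> Prop) K (f : X -> R) :
  compact op K -> (forall x, nbhd op x (fun y => Rabs (f y - f x) < 1)) ->
  exists M, forall x, K x -> f x <= M.
Proof.
  intros HK Hf.
  apply (compact_ind op K (fun A => exists M, forall x, A x -> f x <= M)); auto.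
  - split; [|split].
    + exists 0; tauto.
    + intros A B (M & HA) (M' & HB); exists (Rmax M M'); intros x [?|?].
      * apply Rle_trans with M; auto; apply Rmax_l.
      * apply Rle_trans with M'; auto; apply Rmax_r.
    + intros A B HAB (M & HB); exists M; auto.
  - intros x _; exists (fun y => Rabs (f y - f x) < 1); split; auto.
    exists (f x + 1); intros y (Hy & _); apply Rabs_def2 in Hy; lra.
Qed.

Lemma nbhd_ball {X : Type} (op : (X -> Prop) -> Prop) (d : X -> X -> R) x e :
  is_metric d -> (forall U, metric_open d U -> op U) -> 0 < e ->
  nbhd op x (fun y => d x y < e).
Proof.
  intros (Hp & H0 & Hs & Ht) Hd He.
  apply nbhd_open.
  - apply Hd; intros y Hy; exists (e - d x y); split; [lra|].
    intros z Hz; pose proof (Ht x y z); lra.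
  - assert (d x x = 0) by (apply H0; auto); lra.
Qed.

Lemma inv_nat_small (e : R) : 0 < e -> exists n : nat, / (INR n + 1) < e.
Proof.
  intro He; destruct (archimed_cor1 e He) as (n & Hn & Hp); exists n.
  apply Rlt_trans with (/ INR n); auto.
  apply Rinv_lt_contravar; [|lra].
  apply lt_INR in Hp; simpl in Hp; nra.
Qed.

Lemma inv_nat_pos (n : nat) : 0 < / (INR n + 1).
Proof. apply Rinv_0_lt_compat; pose proof (pos_INR n); lra. Qed.

Lemma inv_nat_anti (n m : nat) : (n <= m)%nat -> / (INR m + 1) <= / (INR n + 1).
Proof.
  intro H; apply Rinv_le_contravar; [pose proof (pos_INR n); lra|].
  apply le_INR in H; lra.
Qed.

Lemma cluster_zero_dist {X : Type} (op : (X -> Prop) -> Prop) (d : X -> X -> R) x c c' :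
  is_metric d -> (forall U, metric_open d U -> op U) ->
  cluster op x c' -> (forall n, d c (x n) < / (INR n + 1)) -> c' = c.
Proof.
  intros Hm Hd Hcl Hlim; pose proof Hm as (Hp & H0 & Hs & Ht).
  apply NNPP; intro Hne.
  assert (Hpos : 0 < d c c').
  { destruct (Hp c c') as [?|E]; auto; symmetry in E; apply H0 in E; congruence. }
  destruct (inv_nat_small (d c c' / 2)) as (n & Hn); [lra|].
  destruct (Hcl (fun y => d c' y < d c c' / 2)) with (M := n) as (m & Hm' & Hd').
  - apply nbhd_ball; auto; lra.
  - pose proof (Hlim m); pose proof (inv_nat_anti n m Hm').
    pose proof (Ht c (x m) c'); rewrite (Hs (x m) c') in *; lra.
Qed.

Definition closure {X : Type} (op : (X -> Prop) -> Prop) (F : X -> Prop) (c : X) : Prop :=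
  forall N, nbhd op c N -> exists y, N y /\ F y.

Definition regular {X : Type} (op : (X -> Prop) -> Prop) : Prop :=
  forall x N, nbhd op x N -> exists M, nbhd op x M /\ forall y, closure op M y -> N y.

Lemma ideal_list {X : Type} (P : (X -> Prop) -> Prop) (F : X -> Prop) (B : X -> X -> Prop)
  (l : list X) :
  ideal P -> (forall x, F x -> P (fun y => B x y)) -> (forall x, In x l -> F x) ->
  P (fun y => exists x, In x l /\ B x y).
Proof.
  intros (H0 & HU & HM) HB; induction l as [|a l IH]; intro Hl.
  - refine (HM _ _ _ H0); intros y (x & [] & _).
  - refine (HM _ _ _ (HU _ _ (HB a _) (IH _))).
    + intros y (x & [->|?] & ?); eauto.
    + apply Hl; left; auto.
    + intros; apply Hl; right; auto.
Qed.

(** Finitely many sets [B x] never cover [F], since their union with trace in [F] lies in the ideal.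
    So a new point outside all previous [B x] can always be chosen. *)
Lemma ideal_not_covered {X : Type} (P : (X -> Prop) -> Prop) (F : X -> Prop) (B : X -> X -> Prop) :
  ideal P -> ~ P F -> (forall x, F x -> P (fun y => B x y /\ F y)) ->
  exists x : nat -> X, (forall n, F (x n)) /\ forall n m, (n < m)%nat -> ~ B (x n) (x m).
Proof.
  intros HP HnF HB.
  assert (Hstep : forall l : {l : list X | forall x, In x l -> F x},
    {y | F y /\ forall x, In x (proj1_sig l) -> ~ B x y}).
  { intros [l Hl]; apply constructive_indefinite_description; apply NNPP; intro Hno.
    apply HnF; pose proof (ideal_list P F _ l HP HB Hl) as Hc.
    refine (proj2 (proj2 HP) _ _ _ Hc); intros y Fy; apply NNPP; intro H.
    apply Hno; exists y; split; auto; intros x Hx HBx; apply H; exists x; auto. }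
  set (next := fun l => proj1_sig (Hstep l)).
  assert (Hn : forall l, F (next l) /\ forall x, In x (proj1_sig l) -> ~ B x (next l))
    by (intro l; exact (proj2_sig (Hstep l))).
  assert (Hcons : forall l : {l : list X | forall x, In x l -> F x},
    forall x, In x (next l :: proj1_sig l) -> F x).
  { intros l x [<-|Hx]; [apply Hn | exact (proj2_sig l x Hx)]. }
  assert (Hnil : forall x : X, In x nil -> F x) by (intros x []).
  (* The recursion carries the list of all earlier points together with the proof that they lie in
     [F]. *)
  set (ls := fix ls n : {l : list X | forall x, In x l -> F x} :=
    match n with
    | O => exist _ nil Hnil
    | S n => exist _ (next (ls n) :: proj1_sig (ls n)) (Hcons (ls n))
    end).
  exists (fun n => next (ls n)); split; [intro; apply Hn|].
  intros n m Hnm; apply Hn; induction Hnm as [|m Hnm IH].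
  - simpl; auto.
  - simpl; auto.
Qed.

(* Lebesgue number and total boundedness with respect to the coarser metric;
   regularity then passes from [F] to its closure. *)
Lemma compact_closure {X : Type} (op : (X -> Prop) -> Prop) (d : X -> X -> R) (F : X -> Prop) :
  is_topology op -> regular op -> is_metric d -> (forall U, metric_open d U -> op U) ->
  (forall x : nat -> X, (forall n, F (x n)) -> exists c, cluster op x c) ->
  compact op (closure op F).
Proof.
  intros Htop Hreg Hm Hd Hcl; pose proof Hm as (Hp & H0 & Hs & Ht).
  assert (HclF : forall x c, (forall n, F (x n)) -> cluster op x c -> closure op F c).
  { intros x c Hx Hc N HN; destruct (Hc N HN O) as (n & _ & ?); eauto. }
  assert (Hcore : forall P, ideal P ->
    (forall c, closure op F c -> exists N, nbhd op c N /\ P N) -> P F).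
  { intros P HP Hloc; pose proof HP as (HP0 & HPU & HPM).
    assert (exists n, forall x, F x -> P (fun y => d x y < / (INR n + 1) /\ F y)) as (n & Hn).
    { apply NNPP; intro Hno.
      assert (Hx : forall n, exists x, F x /\ ~ P (fun y => d x y < / (INR n + 1) /\ F y)).
      { intro n; apply NNPP; intro H; apply Hno; exists n; intros x Fx; apply NNPP; intro H'.
        apply H; eauto. }
      apply choice in Hx; destruct Hx as (x & Hx).
      destruct (Hcl x) as (c & Hc); [intro; apply Hx|].
      destruct (Hloc c) as (V & HV & PV); [apply (HclF x); auto; intro; apply Hx|].
      (* Small balls around late terms of [x] lie in small balls around [c]. As their traces are not
         in the ideal, [V] cannot contain them; the points left out cluster at [c], which
         contradicts that [V] is a neighborhood of [c]. *)
      assert (Hk : forall k, exists y, F y /\ ~ V y /\ d c y < / (INR k + 1)).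
      { intro k; destruct (inv_nat_small (/ (INR k + 1) / 2)) as (M & HM).
        { pose proof (inv_nat_pos k); lra. }
        destruct (Hc (fun y => d c y < / (INR k + 1) / 2)) with (M := M) as (n & Hn & Hdn).
        { apply nbhd_ball; auto; pose proof (inv_nat_pos k); lra. }
        destruct (Hx n) as (_ & HnP); apply NNPP; intro H.
        apply HnP; refine (HPM _ _ _ PV); intros y (Hy & Fy); apply NNPP; intro nVy.
        apply H; exists y; repeat split; auto.
        pose proof (inv_nat_anti M n Hn); pose proof (Ht c (x n) y); lra. }
      apply choice in Hk; destruct Hk as (z & Hz).
      destruct (Hcl z) as (c' & Hc'); [intro; apply Hz|].
      assert (c' = c) as ->.
      { apply (cluster_zero_dist op d z); auto; intro; apply Hz. }
      destruct (Hc' V HV O) as (k & _ & Vk); destruct (Hz k) as (_ & ? & _); auto. }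
    apply NNPP; intro HnP.
    destruct (ideal_not_covered P F (fun x y => d x y < / (INR n + 1))) as (x & Fx & Hx); auto.
    destruct (Hcl x Fx) as (c & Hc).
    assert (HB : nbhd op c (fun y => d c y < / (INR n + 1) / 2)).
    { apply nbhd_ball; auto; pose proof (inv_nat_pos n); lra. }
    destruct (Hc _ HB O) as (i & _ & Hi); destruct (Hc _ HB (S i)) as (j & Hj & Hj').
    apply (Hx i j); [lia|].
    pose proof (Ht (x i) c (x j)); rewrite (Hs (x i) c) in *; lra. }
  apply compact_of_ideals; intros P (HP0 & HPU & HPM) Hloc.
  (* The sets whose closure lies in [P] form an ideal, and regularity makes it locally present. *)
  apply (Hcore (fun A => P (closure op A))).
  - split; [|split].
    + refine (HPM _ _ _ HP0); intros y Hy.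
      destruct (Hy _ (nbhd_true op y Htop)) as (? & _ & []).
    + intros A B HA HB; refine (HPM _ _ _ (HPU _ _ HA HB)); intros y Hy.
      apply NNPP; intro Hno; apply not_or_and in Hno; destruct Hno as (HnA & HnB).
      apply not_all_ex_not in HnA; apply not_all_ex_not in HnB.
      destruct HnA as (N & HN); destruct HnB as (M & HM).
      apply imply_to_and in HN; apply imply_to_and in HM.
      destruct (Hy (fun y => N y /\ M y)) as (z & (? & ?) & [?|?]).
      * apply nbhd_and; tauto.
      * apply (proj2 HN); eauto.
      * apply (proj2 HM); eauto.
    + intros A B HAB HB; refine (HPM _ _ _ HB); intros y Hy N HN.
      destruct (Hy N HN) as (z & ? & ?); eauto.
  - intros c Fc; destruct (Hloc c Fc) as (N & HN & PN).
    destruct (Hreg c N HN) as (M & HM & HMN); exists M; split; auto.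
    refine (HPM _ _ _ PN); auto.
Qed.

(** A sequence in [F] that returns to some compact set infinitely often has a cluster point there;
    if no sequence escapes, [compact_closure] applies. *)
Lemma compact_closure_or_escape {X : Type} (op : (X -> Prop) -> Prop) (d : X -> X -> R)
  (F : X -> Prop) :
  is_topology op -> regular op -> is_metric d -> (forall U, metric_open d U -> op U) ->
  compact op (closure op F) \/
  exists x : nat -> X, (forall n, F (x n)) /\
    forall K, compact op K -> exists M, forall n, (M <= n)%nat -> ~ K (x n).
Proof.
  intros Htop Hreg Hm Hd.
  destruct (classic (exists x : nat -> X, (forall n, F (x n)) /\
    forall K, compact op K -> exists M, forall n, (M <= n)%nat -> ~ K (x n))) as [H|H]; auto.
  left; apply (compact_closure op d); auto; intros x Fx.
  apply NNPP; intro Hno; apply H; exists x; split; auto.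
  intros K HK; apply NNPP; intro HnM; apply Hno.
  destruct (compact_cluster op K x HK) as (c & _ & Hc); eauto.
  intro M; apply NNPP; intro HM; apply HnM; exists M; intros n Hn Kn; apply HM; eauto.
Qed.

Lemma subset_closure {X : Type} (op : (X -> Prop) -> Prop) (F : X -> Prop) x :
  F x -> closure op F x.
Proof. intros Fx N HN; exists x; split; auto; exact (nbhd_self _ _ _ HN). Qed.

(** * Group topologies on the free abelian group *)

Lemma FA_ext {X : Type} (a b : FA X) : (forall x, proj1_sig a x = proj1_sig b x) -> a = b.
Proof.
  destruct a as [a Ha], b as [b Hb]; simpl; intro H.
  apply subset_eq_compat; apply functional_extensionality; exact H.
Qed.

Definition FA_zero {X : Type} : FA X :=
  exist _ (fun _ => 0%Z) (ex_intro _ nil (fun x (H : 0%Z <> 0%Z) => False_ind _ (H eq_refl))).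

Definition FA_sub {X : Type} (a b : FA X) : FA X := FA_add a (FA_opp b).

Definition FA_mul {X : Type} (n : nat) (a : FA X) : FA X := Nat.iter n (FA_add a) FA_zero.

Ltac fa := apply FA_ext; intro; simpl; lia.

Lemma FA_sub_add {X : Type} (a b : FA X) : FA_add b (FA_sub a b) = a.
Proof. fa. Qed.

Lemma FA_add_sub {X : Type} (a b : FA X) : FA_sub (FA_add a b) a = b.
Proof. fa. Qed.

Lemma FA_add_zero {X : Type} (a : FA X) : FA_add a FA_zero = a.
Proof. fa. Qed.

Lemma FA_sub_self {X : Type} (a : FA X) : FA_sub a a = FA_zero.
Proof. fa. Qed.

Lemma eta_injective {X : Type} (x y : X) : eta x = eta y -> x = y.
Proof.
  intro H; apply (f_equal (fun g => proj1_sig g x)) in H; simpl in H; unfold delta in H.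
  destruct (excluded_middle_informative (x = x)); [|congruence].
  destruct (excluded_middle_informative (x = y)); [auto|discriminate].
Qed.

Section GroupTopology.
Context {X : Type} (sg : (FA X -> Prop) -> Prop) (Hg : group_topology sg).

Lemma add_nbhd a b N : nbhd sg (FA_add a b) N ->
  exists A B, nbhd sg a A /\ nbhd sg b B /\ forall u v, A u -> B v -> N (FA_add u v).
Proof.
  intros (W & HW & Wab & HWN); destruct Hg as (_ & Hadd & _).
  destruct (Hadd W HW a b Wab) as (U & V & HU & HV & Ua & Vb & H).
  exists U, V; repeat split; auto; apply nbhd_open; auto.
Qed.

Lemma opp_nbhd a N : nbhd sg (FA_opp a) N -> nbhd sg a (fun u => N (FA_opp u)).
Proof.
  intros (W & HW & Wa & HWN); destruct Hg as (_ & _ & Hopp).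
  exists (fun u => W (FA_opp u)); repeat split; auto.
Qed.

Lemma sub_nbhd a b N : nbhd sg (FA_sub a b) N ->
  exists A B, nbhd sg a A /\ nbhd sg b B /\ forall u v, A u -> B v -> N (FA_sub u v).
Proof.
  intro HN; destruct (add_nbhd _ _ _ HN) as (A & B & HA & HB & H).
  exists A, (fun v => B (FA_opp v)); repeat split; auto; [apply opp_nbhd; auto|].
  intros; apply H; auto.
Qed.

Lemma translate_nbhd c a N : nbhd sg (FA_add c a) N -> nbhd sg a (fun u => N (FA_add c u)).
Proof.
  intro HN; destruct (add_nbhd _ _ _ HN) as (A & B & HA & HB & H).
  apply (nbhd_mono _ _ B); auto; intros; apply H; auto; exact (nbhd_self _ _ _ HA).
Qed.

Lemma nbhd_zero_translate a N : nbhd sg a N -> nbhd sg FA_zero (fun u => N (FA_add a u)).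
Proof. intro H; apply translate_nbhd; rewrite FA_add_zero; auto. Qed.

Lemma nbhd_of_zero a N : nbhd sg FA_zero N -> nbhd sg a (fun u => N (FA_sub u a)).
Proof.
  intro H; assert (H' : nbhd sg (FA_add (FA_opp a) a) N).
  { replace (FA_add (FA_opp a) a) with (@FA_zero X) by fa; auto. }
  apply translate_nbhd in H'; apply (nbhd_mono _ _ _ _ H'); intro u.
  replace (FA_add (FA_opp a) u) with (FA_sub u a) by fa; auto.
Qed.

Lemma half_nbhd N : nbhd sg FA_zero N ->
  exists M, nbhd sg FA_zero M /\ forall u v, M u -> M v -> N (FA_add u v).
Proof.
  intro H; rewrite <- (FA_add_zero FA_zero) in H.
  destruct (add_nbhd _ _ _ H) as (A & B & HA & HB & HAB).
  exists (fun u => A u /\ B u); split; [apply nbhd_and; auto; apply Hg|].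
  intros u v (? & _) (_ & ?); auto.
Qed.

Lemma symmetric_nbhd N : nbhd sg FA_zero N -> nbhd sg FA_zero (fun u => N (FA_opp u)).
Proof.
  intro H; apply opp_nbhd; replace (FA_opp FA_zero) with (@FA_zero X) by fa; auto.
Qed.

(** If $M + M \subseteq N - a$, then the closure of $a + M$ lies in $N$: choose $z \in a + M$ with
    $y - z \in M$ and write $y = a + (z - a) + (y - z)$. *)
Lemma group_regular : regular sg.
Proof.
  intros a N HN; apply nbhd_zero_translate in HN.
  destruct (half_nbhd _ HN) as (M & HM & HMN).
  exists (fun u => M (FA_sub u a)); split; [apply nbhd_of_zero; auto|].
  intros y Hy.
  destruct (Hy (fun z => M (FA_opp (FA_sub z y)))) as (z & Hz & Hza).
  - apply (nbhd_of_zero y (fun u => M (FA_opp u))); apply symmetric_nbhd; auto.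
  - replace y with (FA_add a (FA_add (FA_sub z a) (FA_opp (FA_sub z y)))) by fa; auto.
Qed.

Lemma compact_add K L : compact sg K -> compact sg L ->
  compact sg (fun g => exists u v, K u /\ L v /\ g = FA_add u v).
Proof.
  intros HK HL.
  rewrite (set_ext _ (fun g => exists p : FA X * FA X,
    (K (fst p) /\ L (snd p)) /\ g = FA_add (fst p) (snd p))).
  - apply (compact_image (prod_open sg sg) sg (fun p => FA_add (fst p) (snd p))).
    + intros W HW p Wp; destruct (add_nbhd (fst p) (snd p) W) as (A & B & ? & ? & ?).
      * apply nbhd_open; auto.
      * exists A, B; auto.
    + apply compact_prod; auto; apply Hg.
  - intro g; split.
    + intros (u & v & ? & ? & ->); exists (u, v); auto.
    + intros ((u & v) & (? & ?) & ->); exists u, v; auto.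
Qed.

Lemma compact_sub K L : compact sg K -> compact sg L ->
  compact sg (fun g => exists u v, K u /\ L v /\ g = FA_sub u v).
Proof.
  intros HK HL.
  assert (HL' : compact sg (fun g => exists v, L v /\ g = FA_opp v)).
  { apply (compact_image sg sg FA_opp); auto; intros W HW; apply Hg; auto. }
  pose proof (compact_add _ _ HK HL') as H; revert H.
  match goal with |- compact _ ?A -> compact _ ?B => replace B with A; auto end.
  apply set_ext; intro g; split.
  - intros (u & ? & ? & (v & ? & ->) & ->); exists u, v; auto.
  - intros (u & v & ? & ? & ->); exists u, (FA_opp v); repeat split; eauto.
Qed.

Lemma compact_translate K a : compact sg K -> compact sg (fun g => K (FA_add a g)).
Proof.
  intro HK; pose proof (compact_sub _ _ HK (compact_point sg a)) as H; revert H.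
  match goal with |- compact _ ?A -> compact _ ?B => replace B with A; auto end.
  apply set_ext; intro g; split.
  - intros (u & v & ? & -> & ->); rewrite FA_sub_add; auto.
  - intro; exists (FA_add a g), a; repeat split; auto; fa.
Qed.

Lemma mul_nbhd n a N : nbhd sg (FA_mul n a) N -> nbhd sg a (fun u => N (FA_mul n u)).
Proof.
  revert N; induction n as [|n IH]; intros N HN.
  - apply nbhd_mono with (fun _ => True); [apply nbhd_true; apply Hg|].
    intros; exact (nbhd_self _ _ _ HN).
  - simpl in HN; destruct (add_nbhd _ _ _ HN) as (A & B & HA & HB & HAB).
    apply nbhd_mono with (fun u => A u /\ B (FA_mul n u)).
    + apply nbhd_and; auto; apply Hg.
    + intros u (? & ?); simpl; auto.
Qed.

Lemma compact_uniform_nbhd K N : compact sg K -> (forall g, K g -> nbhd sg g N) ->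
  exists W, nbhd sg FA_zero W /\ forall g w, K g -> W w -> N (FA_add g w).
Proof.
  intros HK HN.
  apply (compact_ind sg K (fun A => exists W, nbhd sg FA_zero W /\
    forall g w, A g -> W w -> N (FA_add g w))); auto.
  - split; [|split].
    + exists (fun _ => True); split; [apply nbhd_true; apply Hg | tauto].
    + intros A B (W & HW & HA) (W' & HW' & HB); exists (fun u => W u /\ W' u).
      split; [apply nbhd_and; auto; apply Hg|]; intros g w [?|?] (? & ?); auto.
    + intros A B HAB (W & HW & HB); exists W; auto.
  - intros g Kg; specialize (HN g Kg); rewrite <- (FA_add_zero g) in HN.
    destruct (add_nbhd _ _ _ HN) as (A & B & HA & HB & HAB).
    exists A; split; auto; exists B; split; auto; intros ? ? (? & _); auto.
Qed.

End GroupTopology.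

(** * Group topologies generated by a base at 0, and the finest one *)

(** Members of [B] serve as neighborhoods of 0; they need not be open themselves. *)
Definition base_top {X : Type} (B : (FA X -> Prop) -> Prop) (W : FA X -> Prop) : Prop :=
  forall g, W g -> exists A, B A /\ forall u, A u -> W (FA_add g u).

Section BaseTopology.
Context {X : Type} (op : (X -> Prop) -> Prop) (B : (FA X -> Prop) -> Prop).
Context (Htop : is_topology op) (Hne : exists A, B A) (H0 : forall A, B A -> A FA_zero).
Context (Hand : forall A A', B A -> B A' -> exists C, B C /\ forall u, C u -> A u /\ A' u).
Context (Hadd : forall A, B A ->
  exists C, B C /\ forall u v, C u -> C v -> A (FA_add u v)).
Context (Hopp : forall A, B A -> exists C, B C /\ forall u, C u -> A (FA_opp u)).
Context (Heta : forall A x, B A -> nbhd op x (fun y => A (FA_sub (eta y) (eta x)))).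

Lemma base_top_nbhd A g : B A -> nbhd (base_top B) g (fun h => A (FA_sub h g)).
Proof.
  (* The interior of the translate of [A]; its openness comes from halving [E]. *)
  intro HA; exists (fun h => exists E, B E /\ forall u, E u -> A (FA_sub (FA_add h u) g)).
  split; [|split].
  - intros h (E & HE & HEA); destruct (Hadd E HE) as (C & HC & HCE).
    exists C; split; auto; intros u Cu; exists C; split; auto.
    intros v Cv; replace (FA_add (FA_add h u) v) with (FA_add h (FA_add u v)) by fa; auto.
  - exists A; split; auto; intros u Au; rewrite FA_add_sub; auto.
  - intros h (E & HE & HEA); specialize (HEA _ (H0 E HE)); rewrite FA_add_zero in HEA; auto.
Qed.

(** The usual axioms of a base at 0, together with continuity of [eta], give an admissible topology.
    Explicit neighborhoods of 0 in $A(X)$ are obtained in this way. *)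
Lemma base_top_admissible : admissible op (base_top B).
Proof.
  assert (Htb : is_topology (base_top B)).
  { split; [|split].
    - intros g _; destruct Hne as (A & HA); eauto.
    - intros U V HU HV g (Ug & Vg).
      destruct (HU g Ug) as (A & HA & HAU); destruct (HV g Vg) as (A' & HA' & HAV).
      destruct (Hand A A' HA HA') as (C & HC & HCA); exists C; split; auto.
      intros u Cu; apply HCA in Cu; intuition.
    - intros F HF g (U & FU & Ug); destruct (HF U FU g Ug) as (A & HA & HAU).
      exists A; split; auto; intros u Au; exists U; auto. }
  split; [split; [|split]|]; auto.
  - intros W HW a b Wab; destruct (HW _ Wab) as (A & HA & HAW).
    destruct (Hadd A HA) as (C & HC & HCA).
    destruct (base_top_nbhd C a HC) as (U & HU & Ua & HUC).
    destruct (base_top_nbhd C b HC) as (V & HV & Vb & HVC).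
    exists U, V; repeat split; auto; intros u v Uu Vv.
    replace (FA_add u v) with
      (FA_add (FA_add a b) (FA_add (FA_sub u a) (FA_sub v b))) by fa; auto.
  - intros W HW a Wa; destruct (HW _ Wa) as (A & HA & HAW).
    destruct (Hopp A HA) as (C & HC & HCA); exists C; split; auto.
    intros u Cu; replace (FA_opp (FA_add a u)) with (FA_add (FA_opp a) (FA_opp u)) by fa; auto.
  - intros W HW; apply open_of_nbhd; auto; intros x Wx.
    destruct (HW _ Wx) as (A & HA & HAW).
    apply (nbhd_mono _ _ _ _ (Heta A x HA)); intros y Hy.
    rewrite <- (FA_sub_add (eta y) (eta x)); auto.
Qed.

End BaseTopology.

Lemma admissible_translate {X : Type} (op : (X -> Prop) -> Prop) sg (U : FA X -> Prop) x :
  admissible op sg -> nbhd sg FA_zero U -> nbhd op x (fun y => U (FA_sub (eta y) (eta x))).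
Proof.
  intros (Hg & He) HU.
  apply (continuous_nbhd op sg eta x (fun g => U (FA_sub g (eta x)))); auto.
  apply nbhd_of_zero; auto.
Qed.

(** A base at 0 of the supremum of all admissible topologies, closed under finite intersections by
    construction. *)
Inductive sup_base {X : Type} (op : (X -> Prop) -> Prop) : (FA X -> Prop) -> Prop :=
| sup_base_nbhd sg A : admissible op sg -> nbhd sg FA_zero A -> sup_base op A
| sup_base_and A A' : sup_base op A -> sup_base op A' -> sup_base op (fun u => A u /\ A' u).

Lemma A_open_admissible {X : Type} (op : (X -> Prop) -> Prop) :
  is_topology op -> admissible op (A_open op).
Proof.
  intro Htop.
  assert (Had : admissible op (base_top (sup_base op))).
  { apply base_top_admissible; auto.
    - exists (fun _ => True).
      (* The indiscrete topology is admissible, so the base is not empty. *)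
      apply (sup_base_nbhd op (base_top (fun A => A = fun _ => True))).
      + apply base_top_admissible; auto.
        * exists (fun _ => True); auto.
        * intros A ->; auto.
        * intros A A' -> ->; exists (fun _ => True); auto.
        * intros A ->; exists (fun _ => True); auto.
        * intros A ->; exists (fun _ => True); auto.
        * intros A x ->; apply nbhd_true; auto.
      + exists (fun _ => True); repeat split; auto; intros ? _.
        exists (fun _ => True); auto.
    - intros A HA; induction HA as [sg A Hs HA|]; auto; exact (nbhd_self _ _ _ HA).
    - intros A A' HA HA'; exists (fun u => A u /\ A' u); split; auto.
      apply sup_base_and; auto.
    - intros A HA; induction HA as [sg A Hs HA|A A' HA (C & HC & HCA) HA' (C' & HC' & HCA')].
      + destruct (half_nbhd sg (proj1 Hs) A HA) as (M & HM & HMA); exists M; split; auto.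
        apply (sup_base_nbhd op sg); auto.
      + exists (fun u => C u /\ C' u); split; [apply sup_base_and; auto|].
        intros u v (? & ?) (? & ?); auto.
    - intros A HA; induction HA as [sg A Hs HA|A A' HA (C & HC & HCA) HA' (C' & HC' & HCA')].
      + exists (fun u => A (FA_opp u)); split.
        * apply (sup_base_nbhd op sg); auto; apply symmetric_nbhd; auto; apply Hs.
        * intros u Hu; exact Hu.
      + exists (fun u => C u /\ C' u); split; [apply sup_base_and; auto|].
        intros u (? & ?); auto.
    - intros A x HA; induction HA as [sg A Hs HA|].
      + apply (admissible_translate op sg); auto.
      + apply (nbhd_and op x (fun y => A (FA_sub (eta y) (eta x)))
          (fun y => A' (FA_sub (eta y) (eta x)))); auto. }
  (* The supremum is one of the admissible topologies and contains all the others, so it is their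
     union. *)
  replace (A_open op) with (base_top (sup_base op)); auto.
  apply set_ext; intro U; split.
  - intro HU; exists (base_top (sup_base op)); auto.
  - intros (sg & Hs & HU) g Ug; exists (fun u => U (FA_add g u)); split; auto.
    apply (sup_base_nbhd op sg); auto; apply nbhd_zero_translate; [apply Hs|].
    apply nbhd_open; auto.
Qed.

Lemma A_open_nbhd {X : Type} (op : (X -> Prop) -> Prop) sg g (N : FA X -> Prop) :
  admissible op sg -> nbhd sg g N -> nbhd (A_open op) g N.
Proof. intros Hs (V & HV & Vg & H); exists V; repeat split; auto; exists sg; auto. Qed.

(** * Real functions and their homomorphic extensions to $A(X)$ *)

Definition Rcont {X : Type} (op : (X -> Prop) -> Prop) (f : X -> R) : Prop :=
  forall x e, 0 < e -> nbhd op x (fun y => Rabs (f y - f x) < e).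

Lemma Rcont_of_continuous {X : Type} (op : (X -> Prop) -> Prop) (f : X -> R) :
  continuous op R_open f -> Rcont op f.
Proof.
  intros Hf x e He; apply (nbhd_open op x (fun y => Rabs (f y - f x) < e)).
  - apply (Hf (fun r => Rabs (r - f x) < e)); intros r Hr.
    exists (e - Rabs (r - f x)); split; [lra|]; intros s Hs.
    pose proof (Rabs_triang (s - r) (r - f x)) as H.
    replace (s - r + (r - f x)) with (s - f x) in H by ring.
    rewrite (Rabs_minus_sym s r) in H; lra.
  - replace (f x - f x) with 0 by ring; rewrite Rabs_R0; auto.
Qed.

Lemma Rcont_const {X : Type} (op : (X -> Prop) -> Prop) c :
  is_topology op -> Rcont op (fun _ => c).
Proof.
  intros Htop x e He; apply (nbhd_mono _ _ (fun _ => True)); [apply nbhd_true; auto|].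
  intros _ _; replace (c - c) with 0 by ring; rewrite Rabs_R0; auto.
Qed.

Definition lsum {X : Type} (l : list X) (h : X -> R) : R :=
  fold_right (fun x s => h x + s) 0 l.

(** After the zero terms are dropped, both lists enumerate the same set without repetition, so they
    are permutations of each other. *)
Lemma lsum_independent {X : Type} (l l' : list X) (h : X -> R) :
  NoDup l -> NoDup l' -> (forall x, h x <> 0 -> In x l) -> (forall x, h x <> 0 -> In x l') ->
  lsum l h = lsum l' h.
Proof.
  intros Hl Hl' Hc Hc'.
  set (b := fun x => if Req_EM_T (h x) 0 then false else true).
  assert (Hf : forall l, lsum l h = lsum (filter b l) h).
  { clear; induction l as [|x l IH]; simpl; auto.
    unfold b at 1; destruct (Req_EM_T (h x) 0) as [E|E]; simpl; rewrite IH, ?E; ring. }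
  assert (Hp : forall l l', Permutation l l' -> lsum l h = lsum l' h).
  { clear; intros l l' H; induction H; simpl; try lra. }
  rewrite (Hf l), (Hf l'); apply Hp; apply NoDup_Permutation; try apply NoDup_filter; auto.
  assert (Hb : forall x, b x = true <-> h x <> 0).
  { intro x; unfold b; destruct (Req_EM_T (h x) 0); split; congruence. }
  intro x; rewrite !filter_In, !Hb; firstorder.
Qed.

Lemma lsum_plus {X : Type} (l : list X) (h k : X -> R) :
  lsum l (fun x => h x + k x) = lsum l h + lsum l k.
Proof. induction l as [|x l IH]; simpl; [ring|]; rewrite IH; ring. Qed.

Lemma support {X : Type} (g : FA X) :
  {l : list X | NoDup l /\ forall x, proj1_sig g x <> 0%Z -> In x l}.
Proof.
  apply constructive_indefinite_description; destruct g as [g [l Hl]]; simpl.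
  exists (nodup (fun x y => excluded_middle_informative (x = y)) l); split.
  - apply NoDup_nodup.
  - intros x Hx; apply nodup_In; auto.
Qed.

(** The homomorphism $A(X) \to \mathbb{R}$ that extends [f]. The support list is chosen arbitrarily;
    [ev_list] removes the dependence on it. *)
Definition ev {X : Type} (f : X -> R) (g : FA X) : R :=
  lsum (proj1_sig (support g)) (fun x => IZR (proj1_sig g x) * f x).

Lemma ev_list {X : Type} (f : X -> R) (g : FA X) l :
  NoDup l -> (forall x, proj1_sig g x <> 0%Z -> In x l) ->
  ev f g = lsum l (fun x => IZR (proj1_sig g x) * f x).
Proof.
  intros Hl Hc; unfold ev; destruct (support g) as (l' & Hl' & Hc'); simpl.
  assert (Hz : forall x, IZR (proj1_sig g x) * f x <> 0 -> proj1_sig g x <> 0%Z).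
  { intros x Hx E; apply Hx; rewrite E; ring. }
  apply lsum_independent; auto.
Qed.

Lemma ev_add {X : Type} (f : X -> R) (a b : FA X) : ev f (FA_add a b) = ev f a + ev f b.
Proof.
  destruct (support a) as (la & Ha & Hca); destruct (support b) as (lb & Hb & Hcb).
  set (l := nodup (fun x y => excluded_middle_informative (x = y)) (la ++ lb)).
  assert (Hl : NoDup l) by apply NoDup_nodup.
  assert (Ia : forall x, proj1_sig a x <> 0%Z -> In x l).
  { intros x Hx; apply nodup_In; apply in_or_app; auto. }
  assert (Ib : forall x, proj1_sig b x <> 0%Z -> In x l).
  { intros x Hx; apply nodup_In; apply in_or_app; auto. }
  rewrite (ev_list f _ l), (ev_list f a l), (ev_list f b l), <- lsum_plus; auto.
  - f_equal; apply functional_extensionality; intro x; simpl; rewrite plus_IZR; ring.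
  - intros x Hx; simpl in Hx; destruct (Z.eq_dec (proj1_sig a x) 0); auto.
    apply Ib; lia.
Qed.

Lemma ev_zero {X : Type} (f : X -> R) : ev f FA_zero = 0.
Proof. pose proof (ev_add f FA_zero FA_zero) as H; rewrite FA_add_zero in H; lra. Qed.

Lemma ev_opp {X : Type} (f : X -> R) (a : FA X) : ev f (FA_opp a) = - ev f a.
Proof.
  pose proof (ev_add f a (FA_opp a)) as H.
  replace (FA_add a (FA_opp a)) with (@FA_zero X) in H by fa; rewrite ev_zero in H; lra.
Qed.

Lemma ev_sub {X : Type} (f : X -> R) (a b : FA X) : ev f (FA_sub a b) = ev f a - ev f b.
Proof. unfold FA_sub; rewrite ev_add, ev_opp; ring. Qed.

Lemma ev_mul {X : Type} (f : X -> R) n (a : FA X) : ev f (FA_mul n a) = INR n * ev f a.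
Proof.
  induction n as [|n IH]; [simpl; rewrite ev_zero; ring|].
  rewrite S_INR; simpl; rewrite ev_add; simpl in IH; rewrite IH; ring.
Qed.

Lemma ev_eta {X : Type} (f : X -> R) x : ev f (eta x) = f x.
Proof.
  rewrite (ev_list f _ (x :: nil)).
  - simpl; unfold delta; destruct (excluded_middle_informative (x = x)); [ring|congruence].
  - constructor; auto; constructor.
  - intros y; simpl; unfold delta; destruct (excluded_middle_informative (y = x)); auto; lia.
Qed.

(** The sets $|ev\,f| < r$ are a base at 0 of an admissible topology, and that of $A(X)$ is
    finer. *)
Lemma ev_continuous {X : Type} (op : (X -> Prop) -> Prop) (f : X -> R) :
  is_topology op -> Rcont op f -> Rcont (A_open op) (ev f).
Proof.
  intros Htop Hf g e He.
  set (B := fun A : FA X -> Prop => exists e, 0 < e /\ A = fun u => Rabs (ev f u) < e).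
  assert (H0 : forall A, B A -> A FA_zero).
  { intros A (r & Hr & ->); rewrite ev_zero, Rabs_R0; auto. }
  assert (Hadd : forall A, B A ->
    exists C, B C /\ forall u v, C u -> C v -> A (FA_add u v)).
  { intros A (r & Hr & ->); exists (fun u => Rabs (ev f u) < r / 2); split.
    - exists (r / 2); split; [lra|auto].
    - intros u v Hu Hv; rewrite ev_add; pose proof (Rabs_triang (ev f u) (ev f v)); lra. }
  apply (A_open_nbhd op (base_top B)).
  - apply base_top_admissible; auto.
    + exists (fun u => Rabs (ev f u) < 1), 1; split; [lra|auto].
    + intros A A' (r & Hr & ->) (r' & Hr' & ->).
      exists (fun u => Rabs (ev f u) < Rmin r r'); split.
      * exists (Rmin r r'); split; auto; apply Rmin_pos; auto.
      * intros u Hu; pose proof (Rmin_l r r'); pose proof (Rmin_r r r'); lra.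
    + intros A (r & Hr & ->); exists (fun u => Rabs (ev f u) < r); split; [exists r; auto|].
      intros u Hu; rewrite ev_opp, Rabs_Ropp; auto.
    + intros A x (r & Hr & ->); apply (nbhd_mono _ _ _ _ (Hf x r Hr)).
      intros y Hy; rewrite ev_sub, !ev_eta; auto.
  - eapply nbhd_mono; [apply (base_top_nbhd B H0 Hadd (fun u => Rabs (ev f u) < e))|].
    + exists e; auto.
    + simpl; intros h Hh; rewrite <- ev_sub; auto.
Qed.

Lemma ev_pointwise {X : Type} (h : nat -> X -> R) (f : X -> R) (g : FA X) :
  (forall x e, 0 < e -> exists M, forall k, (M <= k)%nat -> Rabs (h k x - f x) < e) ->
  forall e, 0 < e -> exists M, forall k, (M <= k)%nat -> Rabs (ev (h k) g - ev f g) < e.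
Proof.
  intro Hlim; unfold ev; generalize (proj1_sig (support g)) as l.
  induction l as [|x l IH]; intros e He; simpl.
  - exists O; intros; replace (0 - 0) with 0 by ring; rewrite Rabs_R0; auto.
  - destruct (IH (e / 2)) as (M & HM); [lra|].
    set (c := Rabs (IZR (proj1_sig g x))); assert (Hc : 0 <= c) by apply Rabs_pos.
    assert (He' : 0 < e / 2 / (c + 1)) by (apply Rdiv_lt_0_compat; lra).
    destruct (Hlim x _ He') as (M' & HM').
    exists (Nat.max M M'); intros k Hk.
    specialize (HM k ltac:(lia)); specialize (HM' k ltac:(lia)).
    set (s := lsum l (fun x => IZR (proj1_sig g x) * h k x)) in *.
    set (t := lsum l (fun x => IZR (proj1_sig g x) * f x)) in *.
    replace (IZR (proj1_sig g x) * h k x + s - (IZR (proj1_sig g x) * f x + t))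
      with (IZR (proj1_sig g x) * (h k x - f x) + (s - t)) by ring.
    eapply Rle_lt_trans; [apply Rabs_triang|]; rewrite Rabs_mult; fold c.
    assert (c * Rabs (h k x - f x) <= e / 2); [|lra].
    apply Rle_trans with ((c + 1) * (e / 2 / (c + 1))).
    + apply Rmult_le_compat; try lra; apply Rabs_pos.
    + right; field; lra.
Qed.

(** * Free groups over submetrizable k_omega-spaces *)

Lemma eta_continuous {X : Type} (op : (X -> Prop) -> Prop) :
  is_topology op -> continuous op (A_open op) eta.
Proof. intro Htop; apply (A_open_admissible op Htop). Qed.

Lemma A_open_group {X : Type} (op : (X -> Prop) -> Prop) :
  is_topology op -> group_topology (A_open op).
Proof. intro Htop; apply (A_open_admissible op Htop). Qed.

Section KOmega.
Context {X : Type} (op : (X -> Prop) -> Prop) (Htop : is_topology op).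
Context (d : X -> X -> R) (Hm : is_metric d) (Hd : forall U, metric_open d U -> op U).
Context (K : nat -> X -> Prop) (HK : forall n, compact op (K n)).
Context (Hinc : forall n x, K n x -> K (S n) x) (Hcov : forall x, exists n, K n x).
Context (Hdet : forall U, (forall n, rel_open op (K n) U) -> op U).

Lemma exhaustion_le n m x : (n <= m)%nat -> K n x -> K m x.
Proof. intro H; induction H; auto. Qed.

(** Zero is listed separately so that [short_sum a n] grows with [n] even when [K n] is empty. *)
Definition short_diff (n k : nat) (t : FA X) : Prop :=
  t = FA_zero \/
  exists x y, K n x /\ K n y /\ d x y <= / (INR k + 1) /\ t = FA_sub (eta x) (eta y).

Fixpoint short_sum (a : nat -> nat) (n : nat) (g : FA X) : Prop :=
  match n with
  | O => g = FA_zero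
  | S n => exists h t, short_sum a n h /\ short_diff n (a n) t /\ g = FA_add h t
  end.

Definition short_sums (a : nat -> nat) (g : FA X) : Prop := exists n, short_sum a n g.

Lemma short_diff_mono n m k j t :
  (n <= m)%nat -> (j <= k)%nat -> short_diff n k t -> short_diff m j t.
Proof.
  intros Hnm Hjk [->|(x & y & Hx & Hy & Hxy & ->)]; [left; auto|right].
  exists x, y; repeat split; try (apply exhaustion_le with n; auto).
  pose proof (inv_nat_anti j k Hjk); lra.
Qed.

Lemma short_sum_le a n m g : (n <= m)%nat -> short_sum a n g -> short_sum a m g.
Proof.
  intros H Hg; induction H; auto; simpl.
  exists g, FA_zero; repeat split; auto; [left; auto | fa].
Qed.

Lemma short_sum_anti a b n g :
  (forall i, (a i <= b i)%nat) -> short_sum b n g -> short_sum a n g.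
Proof.
  intro Hab; revert g; induction n as [|n IH]; intros g; simpl; auto.
  intros (h & t & Hh & Ht & ->); exists h, t; repeat split; auto.
  apply short_diff_mono with n (b n); auto.
Qed.

Lemma short_diff_opp n k t : short_diff n k t -> short_diff n k (FA_opp t).
Proof.
  intros [->|(x & y & Hx & Hy & Hxy & ->)]; [left; fa|right].
  exists y, x; repeat split; auto; [|fa].
  destruct Hm as (_ & _ & Hs & _); rewrite Hs; auto.
Qed.

Lemma short_sum_opp a n g : short_sum a n g -> short_sum a n (FA_opp g).
Proof.
  revert g; induction n as [|n IH]; intros g; simpl; [intros ->; fa|].
  intros (h & t & Hh & Ht & ->); exists (FA_opp h), (FA_opp t); repeat split; auto; [|fa].
  apply short_diff_opp; auto.
Qed.

(** The [i]-th terms of [g] and [h] are placed at positions [2 * i] and [2 * i + 1]; this is allowed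
    because the sets [K] increase and [b i] dominates both bounds. *)
Lemma short_sum_add a b n g h :
  (forall i, (a (2 * i) <= b i)%nat) -> (forall i, (a (2 * i + 1) <= b i)%nat) ->
  short_sum b n g -> short_sum b n h -> short_sum a (2 * n) (FA_add g h).
Proof.
  intros H0 H1; revert g h; induction n as [|n IH]; intros g h.
  - simpl; intros -> ->; fa.
  - intros (g' & t & Hg & Ht & ->) (h' & t' & Hh & Ht' & ->).
    replace (2 * S n)%nat with (S (S (2 * n))) by lia; simpl short_sum.
    exists (FA_add (FA_add g' h') t), t'; split; [|split].
    + exists (FA_add g' h'), t; repeat split; auto.
      apply short_diff_mono with n (b n); [lia | apply H0 | auto].
    + apply short_diff_mono with n (b n); auto; [lia|].
      specialize (H1 n); replace (S (n + (n + 0))) with (2 * n + 1)%nat by lia; auto.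
    + fa.
Qed.

(* Telescoping sums: chains starting at x with steps shorter than 1/(a i + 1) in K_i
   reach a whole neighborhood of x. *)
Lemma short_sums_eta a x : nbhd op x (fun y => short_sums a (FA_sub (eta y) (eta x))).
Proof.
  exists (fun y => exists n, K n y /\ short_sum a n (FA_sub (eta y) (eta x))).
  split; [|split].
  - apply Hdet; intro m; apply rel_open_of_nbhd; auto; intros y Ky (n & Kny & Hn).
    (* The new difference goes to position [p]: after the chain that reaches [y], and late enough
       for [K p] to contain [y] and [z]. *)
    set (p := Nat.max n m).
    apply (nbhd_mono _ _ (fun z => d y z < / (INR (a p) + 1))).
    + apply nbhd_ball; auto; apply inv_nat_pos.
    + intros z Hz Kz; exists (S p); split.
      * apply exhaustion_le with m; auto; lia.
      * exists (FA_sub (eta y) (eta x)), (FA_sub (eta z) (eta y)); split; [|split].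
        -- apply short_sum_le with n; auto; lia.
        -- right; exists z, y; repeat split.
           ++ apply exhaustion_le with m; auto; lia.
           ++ apply exhaustion_le with m; auto; lia.
           ++ destruct Hm as (_ & _ & Hs & _); rewrite Hs; lra.
        -- fa.
  - destruct (Hcov x) as (n & Kx); exists n; split; auto.
    apply short_sum_le with O; [lia|]; rewrite FA_sub_self; simpl; auto.
  - intros y (n & _ & Hn); exists n; auto.
Qed.

Lemma short_sums_nbhd a : nbhd (A_open op) FA_zero (short_sums a).
Proof.
  set (B := fun A : FA X -> Prop => exists a, A = short_sums a).
  assert (H0 : forall A, B A -> A FA_zero).
  { intros A (b & ->); exists O; simpl; auto. }
  assert (Hadd : forall A, B A ->
    exists C, B C /\ forall u v, C u -> C v -> A (FA_add u v)).
  { intros A (b & ->).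
    set (c := fun i => Nat.max (b (2 * i)%nat) (b (2 * i + 1)%nat)).
    exists (short_sums c); split; [exists c; auto|].
    intros u v (n & Hn) (m & Hm'); exists (2 * Nat.max n m)%nat.
    apply short_sum_add with c; unfold c; try (intro; lia).
    - apply short_sum_le with n; auto; lia.
    - apply short_sum_le with m; auto; lia. }
  apply (A_open_nbhd op (base_top B)).
  - apply base_top_admissible; auto.
    + exists (short_sums a), a; auto.
    + intros A A' (b & ->) (c & ->).
      exists (short_sums (fun i => Nat.max (b i) (c i))); split; [eexists; eauto|].
      intros u (n & Hn); split; exists n; (eapply short_sum_anti; [|exact Hn]); intro i; simpl; lia.
    + intros A (b & ->); exists (short_sums b); split; [exists b; auto|].
      intros u (n & Hn); exists n; apply short_sum_opp; auto.
    + intros A x (b & ->); apply short_sums_eta.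
  - eapply nbhd_mono; [apply (base_top_nbhd B H0 Hadd (short_sums a)); exists a; auto|].
    simpl; intros h Hh; replace h with (FA_sub h FA_zero) by fa; auto.
Qed.

(** Compactness of the square of [K n]: near the diagonal, differences lie in [W] by continuity;
    away from it, a large [k] excludes all pairs. *)
Lemma short_diff_small n W : nbhd (A_open op) FA_zero W ->
  exists k, forall t, short_diff n k t -> W t.
Proof.
  intro HW.
  assert (exists k, forall p : X * X, K n (fst p) /\ K n (snd p) ->
    d (fst p) (snd p) <= / (INR k + 1) -> W (FA_sub (eta (fst p)) (eta (snd p)))) as (k & Hk).
  { apply (compact_ind (prod_open op op) (fun p => K n (fst p) /\ K n (snd p))
      (fun A => exists k, forall p, A p -> d (fst p) (snd p) <= / (INR k + 1) ->
        W (FA_sub (eta (fst p)) (eta (snd p))))).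
    - apply compact_prod; auto.
    - split; [|split].
      + exists O; tauto.
      + intros A B (k & HA) (j & HB); exists (Nat.max k j); intros p [?|?] Hp.
        * apply HA; auto; pose proof (inv_nat_anti k (Nat.max k j) ltac:(lia)); lra.
        * apply HB; auto; pose proof (inv_nat_anti j (Nat.max k j) ltac:(lia)); lra.
      + intros A B HAB (k & HB); exists k; auto.
    - intros (x & y) _; destruct (classic (x = y)) as [<-|Hne].
      + destruct (sub_nbhd (A_open op) (A_open_group op Htop) (eta x) (eta x) W)
          as (A & B & HA & HB & HAB); [rewrite FA_sub_self; auto|].
        exists (fun p => A (eta (fst p)) /\ B (eta (snd p))); split.
        * apply (nbhd_prod op op x x (fun u => A (eta u)) (fun u => B (eta u)));
            apply (continuous_nbhd op (A_open op)); auto; apply eta_continuous; auto.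
        * exists O; intros p ((? & ?) & _) _; auto.
      + pose proof Hm as (Hp & H0 & Hs & Ht).
        assert (Hpos : 0 < d x y).
        { destruct (Hp x y) as [?|E]; auto; symmetry in E; apply H0 in E; congruence. }
        (* Moving both points by less than a third of the distance leaves them more than a third
           apart. *)
        destruct (inv_nat_small (d x y / 3)) as (k & Hk); [lra|].
        exists (fun p => d x (fst p) < d x y / 3 /\ d y (snd p) < d x y / 3); split.
        * apply (nbhd_prod op op x y (fun u => d x u < d x y / 3) (fun u => d y u < d x y / 3));
            apply nbhd_ball; auto; lra.
        * exists k; intros (u & v); simpl; intros ((Hu & Hv) & _) Huv; exfalso.
          pose proof (Ht x u y); pose proof (Ht u v y); rewrite (Hs v y) in *; lra. }
  exists k; intros t [->|(x & y & Hx & Hy & Hxy & ->)]; [exact (nbhd_self _ _ _ HW)|].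
  apply (Hk (x, y)); auto.
Qed.

Lemma short_diff_compact n k : compact (A_open op) (short_diff n k).
Proof.
  apply compact_union; [apply compact_point|].
  rewrite (set_ext _ (fun t => exists p : X * X,
    ((K n (fst p) /\ K n (snd p)) /\ d (fst p) (snd p) <= / (INR k + 1)) /\
    t = FA_sub (eta (fst p)) (eta (snd p)))).
  - apply (compact_image (prod_open op op) (A_open op)
      (fun p => FA_sub (eta (fst p)) (eta (snd p)))).
    + intros W HW p Wp.
      destruct (sub_nbhd (A_open op) (A_open_group op Htop) (eta (fst p)) (eta (snd p)) W)
        as (A & B & HA & HB & HAB); [apply nbhd_open; auto|].
      exists (fun u => A (eta u)), (fun u => B (eta u)); repeat split; auto;
        apply (continuous_nbhd op (A_open op)); auto; apply eta_continuous; auto.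
    + apply compact_inter_closed; [apply compact_prod; auto|].
      intros (x & y) Hxy; simpl in *; pose proof Hm as (Hp & H0 & Hs & Ht).
      set (e := (d x y - / (INR k + 1)) / 2).
      exists (fun u => d x u < e), (fun v => d y v < e); repeat split.
      * apply nbhd_ball; auto; unfold e; lra.
      * apply nbhd_ball; auto; unfold e; lra.
      * intros u v Hu Hv Huv; unfold e in *.
        pose proof (Ht x u y); pose proof (Ht u v y); rewrite (Hs v y) in *; lra.
  - intro t; split.
    + intros (x & y & ? & ? & ? & ->); exists (x, y); simpl; auto.
    + intros ((x & y) & ((? & ?) & ?) & ->); exists x, y; simpl in *; auto.
Qed.

(** With $W_0 = W$ and $W_{n+1} + W_{n+1} \subseteq W_n$, choose [a n] so that the differences at
    position [n] lie in $W_{n+1}$. *)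
Lemma short_sums_cofinal W : nbhd (A_open op) FA_zero W ->
  exists a, forall g, short_sums a g -> W g.
Proof.
  intro HW.
  (* Halving is made a total function; its value on a set that is no neighborhood of 0 is
     arbitrary. *)
  assert (Hh : forall N, exists M, nbhd (A_open op) FA_zero N ->
    nbhd (A_open op) FA_zero M /\ forall u v, M u -> M v -> N (FA_add u v)).
  { intro N; destruct (classic (nbhd (A_open op) FA_zero N)) as [HN|HN].
    - destruct (half_nbhd _ (A_open_group op Htop) N HN) as (M & HM); exists M; auto.
    - exists N; tauto. }
  apply choice in Hh; destruct Hh as (half & Hhalf).
  set (Ws := fun n => Nat.iter n half W).
  assert (HWs : forall n, nbhd (A_open op) FA_zero (Ws n)).
  { induction n; simpl; auto; apply Hhalf; auto. }
  assert (Ha : forall n, exists k, forall t, short_diff n k t -> Ws (S n) t).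
  { intro n; apply short_diff_small; auto. }
  apply choice in Ha; destruct Ha as (a & Ha); exists a.
  (* The invariant keeps room for the later terms: a partial sum of length [n] may still be
     increased by any element of [Ws n]. *)
  assert (Hs : forall n g w, short_sum a n g -> Ws n w -> W (FA_add g w)).
  { induction n as [|n IH]; intros g w.
    - simpl; intros -> Hw; replace (FA_add FA_zero w) with w by fa; auto.
    - intros (h & t & Hh & Ht & ->) Hw.
      replace (FA_add (FA_add h t) w) with (FA_add h (FA_add t w)) by fa.
      apply IH; auto; exact (proj2 (Hhalf (Ws n) (HWs n)) t w (Ha n t Ht) Hw). }
  intros g (n & Hn); rewrite <- (FA_add_zero g); apply (Hs n); auto.
  exact (nbhd_self _ _ _ (HWs n)).
Qed.

Lemma k_omega_Gbase : has_Gbase (A_open op).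
Proof.
  pose proof (A_open_group op Htop) as Hg.
  intro x; exists (fun a g => short_sums a (FA_sub g x)); split; [|split].
  - intro a; apply (nbhd_of_zero (A_open op) Hg x (short_sums a)); apply short_sums_nbhd.
  - intros V HV Vx.
    destruct (short_sums_cofinal (fun u => V (FA_add x u))) as (a & Ha).
    + apply nbhd_zero_translate; auto; apply nbhd_open; auto.
    + exists a; intros y Hy; apply Ha in Hy; rewrite FA_sub_add in Hy; auto.
  - intros a b Hab y (n & Hn); exists n; apply short_sum_anti with b; auto.
Qed.

Lemma k_open_nbhd_zero (W : FA X -> Prop) :
  (forall L, compact (A_open op) L -> rel_open (A_open op) L W) -> W FA_zero ->
  nbhd (A_open op) FA_zero W.
Proof.
  intros HW W0; pose proof (A_open_group op Htop) as Hg.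
  (* The bound is needed as a function of the stage and the set, so compactness and inclusion in [W]
     are moved behind the choice of [k]. *)
  assert (Hstep : forall p : nat * (FA X -> Prop), exists k,
    compact (A_open op) (snd p) -> (forall g, snd p g -> W g) ->
    forall g t, snd p g -> short_diff (fst p) k t -> W (FA_add g t)).
  { intros (n & C); simpl.
    destruct (classic (compact (A_open op) C /\ forall g, C g -> W g)) as [(HC & HCW)|H];
      [|exists O; tauto].
    (* One compact set that contains the sums for every [k], since the differences allowed by [k]
       are among those allowed by 0. *)
    pose proof (compact_add _ Hg _ _ HC (short_diff_compact n O)) as HL.
    destruct (HW _ HL) as (V & HV & HVL).
    destruct (compact_uniform_nbhd _ Hg C V HC) as (N & HN & HCN).
    { intros g Cg; apply nbhd_open; auto; apply HVL; auto.
      exists g, FA_zero; repeat split; auto; [left; auto | fa]. }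
    destruct (short_diff_small n N HN) as (k & Hk); exists k; intros _ _ g t Cg Ht.
    apply HVL; auto; exists g, t; repeat split; auto.
    apply short_diff_mono with n k; auto; lia. }
  apply choice in Hstep; destruct Hstep as (F & HF).
  set (C := fix C n := match n with
    | O => fun g => g = FA_zero
    | S n => fun g => exists u v, C n u /\ short_diff n (F (n, C n)) v /\ g = FA_add u v
    end).
  assert (HC : forall n, compact (A_open op) (C n) /\ forall g, C n g -> W g).
  { induction n as [|n (IH & IH')]; simpl.
    - split; [apply compact_point | intros g ->; auto].
    - split; [apply compact_add; auto; apply short_diff_compact|].
      intros g (u & v & Hu & Hv & ->); apply (HF (n, C n)); auto. }
  apply (nbhd_mono _ _ _ _ (short_sums_nbhd (fun n => F (n, C n)))).
  intros g (n & Hn); apply (HC n); revert g Hn.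
  induction n as [|n IH]; intros g; simpl; auto.
  intros (h & t & Hh & Ht & ->); exists h, t; auto.
Qed.

Lemma k_omega_kspace : kspace (A_open op).
Proof.
  pose proof (A_open_group op Htop) as Hg.
  intros W HW; apply open_of_nbhd; [apply Hg|]; intros g Wg.
  assert (H : nbhd (A_open op) FA_zero (fun u => W (FA_add g u))).
  { apply k_open_nbhd_zero; [|rewrite FA_add_zero; auto].
    intros L HL; apply rel_open_of_nbhd; [apply Hg|]; intros u Lu Wu.
    apply (compact_translate _ Hg L (FA_opp g)) in HL; apply HW in HL.
    apply (rel_open_nbhd _ _ _ (FA_add g u)) in HL; auto.
    - apply (translate_nbhd _ Hg g u) in HL.
      apply (nbhd_mono _ _ _ _ HL); simpl; intros v Hv Lv; apply Hv.
      replace (FA_add (FA_opp g) (FA_add g v)) with v by fa; auto.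
    - replace (FA_add (FA_opp g) (FA_add g u)) with u by fa; auto. }
  apply (nbhd_of_zero _ Hg g) in H; apply (nbhd_mono _ _ _ _ H).
  intros y; rewrite FA_sub_add; auto.
Qed.

End KOmega.

(** Over a discrete space the discrete group topology is admissible. *)
Lemma discrete_A_open {X : Type} (op : (X -> Prop) -> Prop) W : discrete op -> A_open op W.
Proof.
  intro Hdis; exists (fun _ => True); split; auto.
  split; [split; [|split]|]; [repeat split; auto| | |]; auto.
  - intros W' _ a b Wab; exists (fun g => g = a), (fun g => g = b); repeat split; auto.
    intros u v -> ->; auto.
  - intros V _; apply Hdis.
Qed.

(** * Submetrizability from a G-base *)

Lemma countable_prod (A B : Type) :
  countable_type A -> countable_type B -> countable_type (A * B).
Proof.
  intros (f & Hf) (g & Hg).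
  exists (fun n => let (i, j) := of_nat n in (f i, g j)); intros (a & b) _.
  destruct (Hf a I) as (i & <-); destruct (Hg b I) as (j & <-).
  exists (to_nat (i, j)); rewrite cancel_of_to; auto.
Qed.

Lemma countable_list (A : Type) : countable_type A -> countable_type (list A).
Proof.
  intros (f & Hf).
  set (dec := fix dec len code := match len with
    | O => nil
    | S len => let (a, b) := of_nat code in f a :: dec len b
    end).
  exists (fun n => let (len, code) := of_nat n in dec len code); intros l _.
  assert (exists code, dec (length l) code = l) as (code & Hc).
  { induction l as [|a l (code & IH)]; [exists O; auto|].
    destruct (Hf a I) as (i & <-); exists (to_nat (i, code)).
    cbn [length dec]; rewrite cancel_of_to, IH; auto. }
  exists (to_nat (length l, code)); rewrite cancel_of_to; auto.
Qed.

Lemma countable_nat : countable_type nat.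
Proof. exists (fun n => n); eauto. Qed.

(** In column [i] only the rows with [k <= i] can differ from [a i], so each column is bounded. *)
Lemma diagonal_bound (a : nat -> nat) (b : nat -> nat -> nat) :
  (forall k i, (i < k)%nat -> b k i = a i) ->
  exists c, (forall i, (a i <= c i)%nat) /\ forall k i, (b k i <= c i)%nat.
Proof.
  intro H.
  assert (Hc : forall i, exists m, (a i <= m)%nat /\ forall k, (b k i <= m)%nat).
  { intro i.
    assert (Hb : forall n, exists m, forall k, (k < n)%nat -> (b k i <= m)%nat).
    { induction n as [|n (m & IH)]; [exists O; lia|].
      exists (Nat.max m (b n i)); intros k Hk.
      destruct (Nat.eq_dec k n) as [->|]; [lia|]; specialize (IH k); lia. }
    destruct (Hb (S i)) as (m & Hm); exists (Nat.max m (a i)); split; [lia|].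
    intro k; destruct (le_lt_dec k i) as [Hk|Hk].
    - specialize (Hm k); lia.
    - rewrite H; lia. }
  apply choice in Hc; destruct Hc as (c & Hc); exists c; split; [|intros k i]; apply Hc.
Qed.

Definition extends (t : list nat) (b : nat -> nat) : Prop :=
  forall i, (i < length t)%nat -> b i = nth i t O.

Definition prefix {A : Type} (a : nat -> A) (k : nat) : list A := map a (seq 0 k).

Lemma length_prefix {A : Type} (a : nat -> A) k : length (prefix a k) = k.
Proof. unfold prefix; rewrite length_map, length_seq; auto. Qed.

Lemma nth_prefix {A : Type} (a : nat -> A) k i e : (i < k)%nat -> nth i (prefix a k) e = a i.
Proof.
  intro H; unfold prefix; rewrite (nth_indep _ e (a O)).
  - rewrite map_nth, seq_nth; auto.
  - rewrite length_map, length_seq; auto.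
Qed.

Lemma extends_prefix a k b :
  extends (prefix a k) b <-> forall i, (i < k)%nat -> b i = a i.
Proof.
  unfold extends; rewrite length_prefix; split; intros H i Hi.
  - rewrite H, nth_prefix; auto.
  - rewrite nth_prefix; auto.
Qed.

Lemma nbhd_forall_lt {X : Type} (op : (X -> Prop) -> Prop) x (P : nat -> X -> Prop) n :
  is_topology op -> (forall i, nbhd op x (P i)) ->
  nbhd op x (fun y => forall i, (i < n)%nat -> P i y).
Proof.
  intros Htop HP; induction n as [|n IH].
  - apply (nbhd_mono _ _ (fun _ => True)); [apply nbhd_true; auto | lia].
  - apply (nbhd_mono _ _ _ _ (nbhd_and _ _ _ _ Htop IH (HP n))).
    intros y (Hy & Hn) i Hi; destruct (Nat.eq_dec i n) as [->|]; auto; apply Hy; lia.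
Qed.

(** * Functions and metrics from countable families *)

(** The supremum of $a_n/(n+1)$, fixed as one function of the sequence, so that equal sequences get
    equal values; outside $[0,1]$ the value 0 is a default. *)
Lemma weighted_sup : exists W : (nat -> R) -> R, forall a, (forall n, 0 <= a n <= 1) ->
  (forall n, a n * / (INR n + 1) <= W a) /\
  forall c, (forall n, a n * / (INR n + 1) <= c) -> W a <= c.
Proof.
  apply choice with (R := fun a s => (forall n : nat, 0 <= a n <= 1) ->
    (forall n, a n * / (INR n + 1) <= s) /\
    forall c, (forall n, a n * / (INR n + 1) <= c) -> s <= c).
  intro a; destruct (classic (forall n, 0 <= a n <= 1)) as [Ha|Ha]; [|exists 0; tauto].
  destruct (completeness (fun r => exists n, r = a n * / (INR n + 1))) as (s & Hub & Hlub).
  - exists 1; intros r (n & ->); specialize (Ha n).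
    pose proof (inv_nat_pos n); pose proof (inv_nat_anti 0 n ltac:(lia)); simpl in *; nra.
  - exists (a O * / (INR O + 1)); eauto.
  - exists s; intros _; split.
    + intro n; apply Hub; eauto.
    + intros c Hc; apply Hlub; intros r (n & ->); auto.
Qed.

Lemma weighted_small (a : nat -> R) (e : R) (N : nat) : (forall n, 0 <= a n <= 1) ->
  / (INR N + 1) < e -> (forall n, (n < N)%nat -> a n < e) ->
  forall n, a n * / (INR n + 1) <= e.
Proof.
  intros Ha HN Hs n; specialize (Ha n); pose proof (inv_nat_pos n).
  destruct (le_lt_dec N n) as [Hn|Hn].
  - pose proof (inv_nat_anti N n Hn); nra.
  - specialize (Hs n Hn); pose proof (inv_nat_anti 0 n ltac:(lia)); simpl in *.
    assert (/ (0 + 1) = 1) by field; nra.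
Qed.

(** The difference of two suprema is at most the supremum of the weighted differences, and there the
    weights leave only finitely many functions to control. *)
Lemma Rcont_weighted_sup {X : Type} (op : (X -> Prop) -> Prop) (f : nat -> X -> R) :
  is_topology op -> (forall n, Rcont op (f n)) -> (forall n x, 0 <= f n x <= 1) ->
  exists F, Rcont op F /\ (forall n x, f n x * / (INR n + 1) <= F x) /\
    forall x, (forall n, f n x = 0) -> F x = 0.
Proof.
  intros Htop Hf Hb; destruct weighted_sup as (W & HW).
  assert (HF : forall x, (forall n, f n x * / (INR n + 1) <= W (fun n => f n x)) /\
    forall c, (forall n, f n x * / (INR n + 1) <= c) -> W (fun n => f n x) <= c).
  { intro x; apply HW; auto. }
  exists (fun x => W (fun n => f n x)); split; [|split].
  - intros x e He; destruct (inv_nat_small (e / 2)) as (N & HN); [lra|].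
    assert (Hn : nbhd op x (fun y => forall n, (n < N)%nat -> Rabs (f n y - f n x) < e / 2)).
    { apply nbhd_forall_lt; auto; intro n; apply Hf; lra. }
    apply (nbhd_mono _ _ _ _ Hn); intros y Hy.
    assert (Hs : forall n, Rabs (f n y - f n x) * / (INR n + 1) <= e / 2).
    { apply weighted_small with N; auto; intro n; split; [apply Rabs_pos|].
      apply Rabs_le; pose proof (Hb n x); pose proof (Hb n y); lra. }
    destruct (HF x) as (Hx & Hx'); destruct (HF y) as (Hy1 & Hy').
    assert (W (fun n => f n y) <= W (fun n => f n x) + e / 2).
    { apply Hy'; intro n; specialize (Hx n); specialize (Hs n).
      pose proof (Rle_abs (f n y - f n x)); pose proof (inv_nat_pos n); nra. }
    assert (W (fun n => f n x) <= W (fun n => f n y) + e / 2).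
    { apply Hx'; intro n; specialize (Hy1 n); specialize (Hs n).
      pose proof (Rle_abs (f n x - f n y)) as HA; rewrite Rabs_minus_sym in HA.
      pose proof (inv_nat_pos n); nra. }
    apply Rabs_def1; lra.
  - intros n x; apply HF.
  - intros x Hx; destruct (HF x) as (H1 & H2); apply Rle_antisym.
    + apply H2; intro n; rewrite Hx; lra.
    + specialize (H1 O); rewrite Hx in H1; lra.
Qed.

(** The metric is $\sup_n \min(1, |f_n(x) - f_n(y)|)/(n+1)$. *)
Lemma submetrizable_of_functions {X : Type} (op : (X -> Prop) -> Prop) (f : nat -> X -> R) :
  is_topology op -> (forall n, Rcont op (f n)) ->
  (forall x y, x <> y -> exists n, f n x <> f n y) -> submetrizable op.
Proof.
  intros Htop Hf Hsep; destruct weighted_sup as (W & HW).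
  set (a := fun x y n => Rmin 1 (Rabs (f n x - f n y))).
  assert (Hb : forall x y n, 0 <= a x y n <= 1).
  { intros x y n; unfold a; split; [|apply Rmin_l].
    apply Rmin_glb; [lra | apply Rabs_pos]. }
  assert (HF : forall x y, (forall n, a x y n * / (INR n + 1) <= W (a x y)) /\
    forall c, (forall n, a x y n * / (INR n + 1) <= c) -> W (a x y) <= c).
  { intros; apply HW; auto. }
  assert (Hp : forall x y, 0 <= W (a x y)).
  { intros x y; pose proof (proj1 (HF x y) O); pose proof (Hb x y O);
      pose proof (inv_nat_pos 0); nra. }
  exists (fun x y => W (a x y)); split; [split; [|split; [|split]]|]; auto.
  - intros x y; split.
    + intro H0; apply NNPP; intro Hne; destruct (Hsep x y Hne) as (n & Hn).
      pose proof (proj1 (HF x y) n) as Hle; rewrite H0 in Hle.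
      assert (0 < a x y n).
      { apply Rmin_glb_lt; [lra|]; apply Rabs_pos_lt; lra. }
      pose proof (inv_nat_pos n); nra.
    + intros <-; apply Rle_antisym; auto; apply HF; intro n.
      unfold a; replace (f n x - f n x) with 0 by ring; rewrite Rabs_R0.
      rewrite Rmin_right by lra; lra.
  - intros x y; f_equal; apply functional_extensionality; intro n; unfold a.
    rewrite Rabs_minus_sym; auto.
  - intros x y z; apply HF; intro n.
    pose proof (proj1 (HF x y) n); pose proof (proj1 (HF y z) n); pose proof (inv_nat_pos n).
    assert (a x z n <= a x y n + a y z n); [|nra].
    unfold a; pose proof (Rabs_triang (f n x - f n y) (f n y - f n z)) as Ht.
    replace (f n x - f n y + (f n y - f n z)) with (f n x - f n z) in Ht by ring.
    pose proof (Rabs_pos (f n x - f n y)); pose proof (Rabs_pos (f n y - f n z)).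
    unfold Rmin; repeat destruct Rle_dec; lra.
  - intros U HU; apply open_of_nbhd; auto; intros x Ux.
    destruct (HU x Ux) as (e & He & HeU).
    destruct (inv_nat_small (e / 2)) as (N & HN); [lra|].
    assert (Hn : nbhd op x (fun y => forall n, (n < N)%nat -> Rabs (f n y - f n x) < e / 2)).
    { apply nbhd_forall_lt; auto; intro n; apply Hf; lra. }
    apply (nbhd_mono _ _ _ _ Hn); intros y Hy; apply HeU.
    apply Rle_lt_trans with (e / 2); [|lra]; apply HF.
    apply weighted_small with N; auto; intros n Hn'.
    apply Rle_lt_trans with (Rabs (f n x - f n y)); [apply Rmin_r|].
    rewrite Rabs_minus_sym; auto.
Qed.

Lemma nbhd_avoid_list {X : Type} (op : (X -> Prop) -> Prop) x (l : list X) :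
  is_topology op -> T1 op -> nbhd op x (fun y => In y l -> y = x).
Proof.
  intros Htop HT; induction l as [|z l IH].
  - apply (nbhd_mono _ _ (fun _ => True)); [apply nbhd_true; auto | simpl; tauto].
  - destruct (classic (x = z)) as [<-|Hne].
    + apply (nbhd_mono _ _ _ _ IH); simpl; firstorder congruence.
    + destruct (HT x z Hne) as (U & HU & Ux & Uz).
      apply (nbhd_mono _ _ _ _ (nbhd_and _ _ _ _ Htop IH (nbhd_open _ _ _ HU Ux))).
      intros y (Hy & Uy) [->|Hin]; auto; contradiction.
Qed.

(** * The closed embedding of a Tychonoff space in $A(X)$ *)

Section Tychonoff.
Context {X : Type} (op : (X -> Prop) -> Prop) (Htop : is_topology op) (Hty : tychonoff op).

Lemma bump x N : nbhd op x N -> exists f, Rcont op f /\ (forall y, 0 <= f y <= 1) /\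
  f x = 1 /\ forall y, ~ N y -> f y = 0.
Proof.
  intros (V & HV & Vx & HVN).
  destruct (proj2 Hty (fun y => ~ V y) x) as (f & Hf & Hfx & HfV & Hfb).
  - rewrite (set_ext _ V); auto; intro; split; [apply NNPP | tauto].
  - tauto.
  - exists (fun y => 1 - f y); split; [|split; [|split]].
    + intros y e He; apply (nbhd_mono _ _ _ _ (Rcont_of_continuous op f Hf y e He)).
      intros z Hz; replace (1 - f z - (1 - f y)) with (- (f z - f y)) by ring.
      rewrite Rabs_Ropp; auto.
    + intro y; specialize (Hfb y); lra.
    + lra.
    + intros y Hy; rewrite HfV; [ring|]; auto.
Qed.

(** A bump at [x] that vanishes at the other points of the support reads off one coefficient. *)
Lemma coefficient_eval (g : FA X) x : exists f, Rcont op f /\ (forall y, 0 <= f y <= 1) /\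
  ev f g = IZR (proj1_sig g x).
Proof.
  destruct (support g) as (l & Hl & Hc).
  destruct (bump x _ (nbhd_avoid_list op x l Htop (proj1 Hty))) as (f & Hf & Hb & Hx & Hz).
  exists f; split; [auto|split; [auto|]].
  rewrite (ev_list f g l), (lsum_independent l (x :: nil)); auto.
  - simpl; rewrite Hx; ring.
  - constructor; auto; constructor.
  - intros y Hy; apply Hc; intro E; apply Hy; rewrite E; ring.
  - intros y Hy; left; symmetry; apply NNPP; intro Hne; apply Hy; rewrite (Hz y); [ring|].
    intro H; apply Hne, H, Hc; intro E; apply Hy; rewrite E; ring.
Qed.

Lemma lsum_ge {A : Type} (l : list A) (h : A -> R) x :
  (forall y, 0 <= h y) -> In x l -> h x <= lsum l h.
Proof.
  intro Hh.
  assert (Hp : forall l, 0 <= lsum l h).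
  { clear l; induction l as [|y l IH]; simpl; [lra|]; specialize (Hh y); lra. }
  induction l as [|y l IH]; intros []; simpl.
  - subst; specialize (Hp l); lra.
  - specialize (IH H); specialize (Hh y); lra.
Qed.

(** Generators are the elements with nonnegative coefficients of sum 1. A negative coefficient is
    detected by a bump function, a wrong sum by the constant 1. *)
Lemma eta_image_closed (g : FA X) :
  ~ (exists x, g = eta x) -> nbhd (A_open op) g (fun h => ~ exists x, h = eta x).
Proof.
  intro Hg.
  destruct (classic (exists x, (proj1_sig g x < 0)%Z)) as [(x & Hx)|Hpos].
  - destruct (coefficient_eval g x) as (f & Hf & Hb & Hev).
    apply (nbhd_mono _ _ _ _ (ev_continuous op f Htop Hf g 1 ltac:(lra))).
    intros h Hh (y & ->); rewrite ev_eta, Hev in Hh.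
    assert (IZR (proj1_sig g x) <= -1) by (apply IZR_le; lia).
    specialize (Hb y); apply Rabs_def2 in Hh; lra.
  - destruct (Req_EM_T (ev (fun _ => 1) g) 1) as [E|E].
    + exfalso; apply Hg.
      (* Applied to [FA_sub g (eta x)], whose coefficients are nonnegative with sum 0, this forces
         [g = eta x]. *)
      assert (Hle : forall a : FA X, (forall y, (0 <= proj1_sig a y)%Z) ->
        forall x, IZR (proj1_sig a x) <= ev (fun _ => 1) a).
      { intros a Ha x; destruct (support a) as (l & Hl & Hc).
        rewrite (ev_list _ a l); auto.
        assert (Hnn : forall y, 0 <= IZR (proj1_sig a y) * 1).
        { intro y; rewrite Rmult_1_r; apply IZR_le; auto. }
        destruct (Z.eq_dec (proj1_sig a x) 0) as [Ez|Ez].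
        - rewrite Ez; destruct l as [|y l]; [simpl; lra|].
          apply Rle_trans with (IZR (proj1_sig a y) * 1); auto.
          apply (lsum_ge (y :: l) (fun z => IZR (proj1_sig a z) * 1)); simpl; auto.
        - rewrite <- (Rmult_1_r (IZR (proj1_sig a x))).
          apply (lsum_ge l (fun z => IZR (proj1_sig a z) * 1)); auto. }
      assert (exists x, proj1_sig g x <> 0%Z) as (x & Hx).
      { apply NNPP; intro Hno; assert (g = FA_zero) as ->.
        - apply FA_ext; intro x; simpl; apply NNPP; eauto.
        - rewrite ev_zero in E; lra. }
      exists x.
      assert (Hnn : forall y, (0 <= proj1_sig (FA_sub g (eta x)) y)%Z).
      { intro y; simpl; unfold delta.
        assert (~ (proj1_sig g y < 0)%Z) by eauto.
        destruct (excluded_middle_informative (y = x)) as [->|]; lia. }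
      rewrite <- (FA_sub_add g (eta x)), <- (FA_add_zero (eta x)) at 1; f_equal.
      apply FA_ext; intro y; specialize (Hle _ Hnn y).
      rewrite ev_sub, ev_eta, E in Hle; specialize (Hnn y).
      assert (proj1_sig (FA_sub g (eta x)) y <= 0)%Z by (apply le_IZR; lra).
      simpl in *; lia.
    + set (r := Rabs (1 - ev (fun _ => 1) g)).
      assert (Hr : 0 < r) by (apply Rabs_pos_lt; lra).
      apply (nbhd_mono _ _ _ _
        (ev_continuous op _ Htop (Rcont_const op 1 Htop) g r Hr)).
      intros h Hh (y & ->); rewrite ev_eta in Hh; fold r in Hh; lra.
Qed.

Lemma eta_embedding x N : nbhd op x N ->
  nbhd (A_open op) (eta x) (fun h => forall y, h = eta y -> N y).
Proof.
  intro HN; destruct (bump x N HN) as (f & Hf & Hb & Hx & Hz).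
  apply (nbhd_mono _ _ _ _ (ev_continuous op f Htop Hf (eta x) 1 ltac:(lra))).
  intros h Hh y ->; apply NNPP; intro H.
  rewrite !ev_eta, Hx, (Hz y H) in Hh; apply Rabs_def2 in Hh; lra.
Qed.

(** [eta] is an embedding with closed image: near a generator the neighborhoods of [X] are
    available, and near any other element the preimage is empty. *)
Lemma compact_eta_preimage L : compact (A_open op) L -> compact op (fun x => L (eta x)).
Proof.
  intro HL; apply compact_of_ideals; intros P (H0 & HU & HM) Hloc.
  apply (compact_ind (A_open op) L (fun A => P (fun x => A (eta x)))); auto.
  - split; [|split]; auto.
    intros A B HAB; apply HM; auto.
  - intros g Lg; destruct (classic (exists x, g = eta x)) as [(x & ->)|Hne].
    + destruct (Hloc x Lg) as (N & HN & PN).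
      exists (fun h => forall y, h = eta y -> N y); split; [apply eta_embedding; auto|].
      refine (HM _ _ _ PN); intros y (Hy & _); auto.
    + exists (fun h => ~ exists x, h = eta x); split; [apply eta_image_closed; auto|].
      refine (HM _ _ _ H0); intros y (Hy & _); eauto.
Qed.

(** The k-property is applied to the complement of the image of the points outside [U]. *)
Lemma kspace_of_free : kspace (A_open op) -> kspace op.
Proof.
  intros Hk U HU.
  assert (HW : A_open op (fun g => forall x, g = eta x -> U x)).
  { apply Hk; intros L HL; pose proof (HU _ (compact_eta_preimage L HL)) as HUL.
    apply rel_open_of_nbhd; [apply A_open_group; auto|]; intros g Lg Hg.
    destruct (classic (exists x, g = eta x)) as [(x & ->)|Hne].
    - pose proof (rel_open_nbhd _ _ _ x HUL Lg (Hg x eq_refl)) as Hn.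
      apply (nbhd_mono _ _ _ _ (eta_embedding x _ Hn)).
      intros h Hh Lh y ->; apply Hh; auto.
    - apply (nbhd_mono _ _ _ _ (eta_image_closed g Hne)).
      intros h Hh _ y ->; exfalso; eauto. }
  rewrite (set_ext U (fun y => forall x, eta y = eta x -> U x)).
  - exact (eta_continuous op Htop _ HW).
  - intro y; split; auto; intros Uy x E; apply eta_injective in E; subst; auto.
Qed.

Lemma submetrizable_of_free : submetrizable (A_open op) -> submetrizable op.
Proof.
  intros (d & (Hp & H0 & Hs & Ht) & Hd).
  assert (Hm : is_metric (fun x y : X => d (eta x) (eta y))).
  { repeat split; auto.
    - intro E; apply eta_injective; apply H0; auto.
    - intros ->; apply H0; auto. }
  exists (fun x y => d (eta x) (eta y)); split; auto.
  intros U HU; apply open_of_nbhd; auto; intros x Ux.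
  destruct (HU x Ux) as (e & He & HeU).
  apply (nbhd_mono _ _ (fun y => d (eta x) (eta y) < e)); auto.
  apply (continuous_nbhd op (A_open op) eta x (fun h => d (eta x) h < e)).
  - apply eta_continuous; auto.
  - apply nbhd_ball; auto; repeat split; auto; apply H0.
Qed.

(* The sequence a codes one index i |-> a (to_nat (n, i)) of the G-base for each n. *)
Definition equicont (U : (nat -> nat) -> FA X -> Prop) (a : nat -> nat) (f : X -> R) : Prop :=
  (forall x, 0 <= f x <= 1) /\
  forall n x y, U (fun i => a (to_nat (n, i))) (FA_sub (eta x) (eta y)) ->
    Rabs (f x - f y) <= / (INR n + 1).

(** * Equicontinuous families measured by a G-base *)

Section Gbase.
Context (U : (nat -> nat) -> FA X -> Prop).
Context (HUn : forall a, nbhd (A_open op) FA_zero (U a)).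
Context (HUc : forall V, nbhd (A_open op) FA_zero V -> exists a, forall y, U a y -> V y).
Context (HUa : forall a b : nat -> nat, (forall n, (a n <= b n)%nat) ->
  forall y, U b y -> U a y).

Lemma U_eta a x : nbhd op x (fun y => U a (FA_sub (eta y) (eta x))).
Proof. apply (admissible_translate op (A_open op)); auto; apply A_open_admissible; auto. Qed.

Lemma equicont_mono a b f : (forall n, (a n <= b n)%nat) -> equicont U a f -> equicont U b f.
Proof.
  intros Hab (Hb & He); split; auto; intros n x y Hxy; apply He; revert Hxy; apply HUa; auto.
Qed.

Lemma equicont_continuous a f : equicont U a f -> Rcont op f.
Proof.
  intros (_ & He) x e Hpos; destruct (inv_nat_small e Hpos) as (n & Hn).
  apply (nbhd_mono _ _ _ _ (U_eta (fun i => a (to_nat (n, i))) x)).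
  intros y Hy; apply He in Hy; lra.
Qed.

(** For each [n] some member of the G-base is mapped by [ev f] into the interval of radius
    $1/(n+1)$; the pairing function merges these indices into one sequence. *)
Lemma continuous_equicont f :
  Rcont op f -> (forall x, 0 <= f x <= 1) -> exists a, equicont U a f.
Proof.
  intros Hf Hb.
  assert (Ha : forall n, exists a, forall g, U a g -> Rabs (ev f g) < / (INR n + 1)).
  { intro n; apply HUc.
    apply (nbhd_mono _ _ _ _ (ev_continuous op f Htop Hf FA_zero _ (inv_nat_pos n))).
    intros g; rewrite ev_zero, Rminus_0_r; auto. }
  apply choice in Ha; destruct Ha as (a & Ha).
  exists (fun c => let (n, i) := of_nat c in a n i); split; auto.
  intros n x y Hxy; rewrite <- (ev_eta f x), <- (ev_eta f y), <- ev_sub.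
  apply Rlt_le, Ha; revert Hxy; apply HUa; intro i; rewrite cancel_of_to; auto.
Qed.

Lemma nat_approximation r k : 0 <= r ->
  exists p : nat, Rabs (r - INR p * / (INR k + 1)) <= / (INR k + 1).
Proof.
  intro Hr; pose proof (inv_nat_pos k) as Hk; pose proof (pos_INR k) as Hk'.
  destruct (archimed (r * (INR k + 1))) as (H1 & H2).
  assert (0 <= up (r * (INR k + 1)))%Z by (apply le_IZR; nra).
  exists (Z.to_nat (up (r * (INR k + 1)))); rewrite INR_IZR_INZ, Z2Nat.id by auto.
  set (z := IZR (up (r * (INR k + 1)))) in *.
  replace (r - z * / (INR k + 1)) with (- ((z - r * (INR k + 1)) * / (INR k + 1)))
    by (field; lra).
  rewrite Rabs_Ropp, Rabs_right; nra.
Qed.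

(* Selecting, for every finite sequence t and every finite table of approximate values on
   the dense set, a function of some class [equicont U b] with b extending t, gives a
   countable set: functions selected along the initial segments of a all lie in one class
   [equicont U c], where convergence on a dense set implies pointwise convergence. *)
Lemma countable_pointwise_dense : separable op ->
  exists S : nat -> X -> R, (forall n, Rcont op (S n)) /\
    forall f, Rcont op f -> (forall x, 0 <= f x <= 1) ->
      exists s : nat -> nat, forall x e, 0 < e ->
        exists M, forall k, (M <= k)%nat -> Rabs (S (s k) x - f x) < e.
Proof.
  intros (D & (q & Hq) & HD).
  assert (Hdense : forall x N, nbhd op x N -> exists j, N (q j)).
  { intros x N (V & HV & Vx & HVN); destruct (HD V HV) as (y & Vy & Dy); eauto.
    destruct (Hq y Dy) as (j & <-); eauto. }
  (* The first list is an initial segment of the modulus; the second, of length [k], holds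
     numerators of approximate values with denominator [k + 1] at the first [k] points of [q]. *)
  set (fits := fun (i : list nat * list nat) f => exists b, extends (fst i) b /\
    equicont U b f /\ forall j, (j < length (snd i))%nat ->
      Rabs (f (q j) - INR (nth j (snd i) O) * / (INR (length (snd i)) + 1))
        <= / (INR (length (snd i)) + 1)).
  assert (HT : forall i, exists f, Rcont op f /\ ((exists f', fits i f') -> fits i f)).
  { intro i; destruct (classic (exists f, fits i f)) as [(f & Hf)|Hno].
    - exists f; split; auto; destruct Hf as (b & _ & He & _).
      apply (equicont_continuous b); auto.
    - exists (fun _ => 0); split; [apply Rcont_const; auto | tauto]. }
  apply choice in HT; destruct HT as (T & HT).
  destruct (countable_prod (list nat) (list nat)) as (enum & Henum);
    try (apply countable_list, countable_nat).
  exists (fun n => T (enum n)); split; [intro; apply HT|].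
  intros f Hf Hb; destruct (continuous_equicont f Hf Hb) as (a & Ha).
  assert (Hs : forall k, exists n b, extends (prefix a k) b /\ equicont U b (T (enum n)) /\
    forall j, (j < k)%nat -> Rabs (T (enum n) (q j) - f (q j)) <= 2 * / (INR k + 1)).
  { intro k.
    assert (Hp : forall j, exists p, Rabs (f (q j) - INR p * / (INR k + 1)) <= / (INR k + 1)).
    { intro j; apply nat_approximation; apply Hb. }
    apply choice in Hp; destruct Hp as (p & Hp).
    destruct (Henum (prefix a k, prefix p k) I) as (n & Hn).
    destruct (proj2 (HT (prefix a k, prefix p k))) as (b & Hb1 & Hb2 & Hb3).
    - exists f, a; simpl; split; [apply extends_prefix; auto|split; auto].
      rewrite length_prefix; intros j Hj; rewrite nth_prefix; auto.
    - exists n, b; rewrite Hn; simpl in *; split; [auto|split; auto].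
      rewrite length_prefix in Hb3; intros j Hj; specialize (Hb3 j Hj).
      rewrite nth_prefix in Hb3 by auto; specialize (Hp j).
      rewrite Rabs_minus_sym in Hp.
      pose proof (Rabs_triang (T (prefix a k, prefix p k) (q j) - INR (p j) * / (INR k + 1))
        (INR (p j) * / (INR k + 1) - f (q j))) as Ht.
      replace (T (prefix a k, prefix p k) (q j) - INR (p j) * / (INR k + 1) +
        (INR (p j) * / (INR k + 1) - f (q j)))
        with (T (prefix a k, prefix p k) (q j) - f (q j)) in Ht by ring.
      lra. }
  apply choice in Hs; destruct Hs as (s & Hs); apply choice in Hs; destruct Hs as (b & Hs).
  destruct (diagonal_bound a b) as (c & Hac & Hbc).
  { intro k; apply extends_prefix; apply Hs. }
  exists s; intros x e He.
  (* The error is at most $1/(n+1)$ for each of the two passages between [x] and [q j], plus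
     $2/(k+1)$ for the comparison at [q j]. *)
  destruct (inv_nat_small (e / 4)) as (n & Hn); [lra|].
  destruct (Hdense x _ (U_eta (fun i => c (to_nat (n, i))) x)) as (j & Hj).
  (* From here on the table of length [k] includes the point [q j]. *)
  exists (Nat.max n (S j)); intros k Hk.
  destruct (Hs k) as (_ & Hek & Hqk); specialize (Hqk j ltac:(lia)).
  assert (H1 : Rabs (T (enum (s k)) (q j) - T (enum (s k)) x) <= / (INR n + 1)).
  { apply (equicont_mono (b k) c); auto. }
  assert (H2 : Rabs (f (q j) - f x) <= / (INR n + 1)).
  { apply (equicont_mono a c); auto. }
  pose proof (inv_nat_anti n k ltac:(lia)).
  set (v := T (enum (s k))) in *.
  replace (v x - f x) with (- (v (q j) - v x) + ((v (q j) - f (q j)) + (f (q j) - f x))) by ring.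
  eapply Rle_lt_trans; [apply Rabs_triang|]; rewrite Rabs_Ropp.
  pose proof (Rabs_triang (v (q j) - f (q j)) (f (q j) - f x)); lra.
Qed.

(** If [g] and [h] differ, some coefficient of the difference is nonzero, so some [ev f] does not
    vanish there; by pointwise approximation neither does [ev (S n)] for some [n]. *)
Lemma free_submetrizable : separable op -> submetrizable (A_open op).
Proof.
  intro Hsep; destruct (countable_pointwise_dense Hsep) as (S & HS & Hdense).
  apply (submetrizable_of_functions _ (fun n => ev (S n))).
  - apply A_open_group; auto.
  - intro n; apply ev_continuous; auto.
  - intros g h Hgh.
    assert (exists x, proj1_sig (FA_sub g h) x <> 0%Z) as (x & Hx).
    { apply NNPP; intro Hno; apply Hgh; apply FA_ext; intro x.
      apply NNPP; intro H; apply Hno; exists x; simpl; lia. }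
    destruct (coefficient_eval (FA_sub g h) x) as (f & Hf & Hb & Hev).
    destruct (Hdense f Hf Hb) as (s & Hs).
    destruct (ev_pointwise (fun k => S (s k)) f (FA_sub g h) Hs (Rabs (ev f (FA_sub g h))))
      as (M & HM).
    + apply Rabs_pos_lt; rewrite Hev; apply not_0_IZR; auto.
    + specialize (HM M (le_n M)); exists (s M); intro E.
      rewrite (ev_sub (S (s M))), E in HM.
      replace (ev (S (s M)) h - ev (S (s M)) h - ev f (FA_sub g h))
        with (- ev f (FA_sub g h)) in HM by ring.
      rewrite Rabs_Ropp in HM; lra.
Qed.

End Gbase.
End Tychonoff.

(** * k-spaces with a G-base *)

Lemma T1_of_metric {X : Type} (op : (X -> Prop) -> Prop) (d : X -> X -> R) :
  is_metric d -> (forall U, metric_open d U -> op U) -> T1 op.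
Proof.
  intros Hm Hd x y Hne; pose proof Hm as (Hp & H0 & _).
  assert (Hpos : 0 < d x y).
  { destruct (Hp x y) as [?|E]; auto; symmetry in E; apply H0 in E; congruence. }
  destruct (nbhd_ball op d x (d x y) Hm Hd Hpos) as (V & HV & Vx & HVd).
  exists V; repeat split; auto; intro Vy; specialize (HVd y Vy); lra.
Qed.

(** A set that is not open has a trace on some compact [K] that is not open. Points of [K] outside
    it approach [s] in the metric, and compactness of [K] turns this into convergence in the
    topology. *)
Lemma convergent_sequence {X : Type} (op : (X -> Prop) -> Prop) :
  is_topology op -> kspace op -> submetrizable op -> ~ discrete op ->
  exists (s : X) (p : nat -> X), (forall m, p m <> s) /\
    forall N, nbhd op s N -> exists M, forall m, (M <= m)%nat -> N (p m).
Proof.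
  intros Htop Hk (d & Hm & Hd) Hnd.
  apply not_all_ex_not in Hnd; destruct Hnd as (U & HU).
  assert (exists K, compact op K /\ ~ rel_open op K U) as (K & HK & HKU).
  { apply NNPP; intro Hno; apply HU, Hk; intros K HK; apply NNPP; intro H; apply Hno; eauto. }
  assert (exists s, K s /\ U s /\ ~ nbhd op s (fun y => K y -> U y)) as (s & Ks & Us & Hs).
  { apply NNPP; intro Hno; apply HKU, rel_open_of_nbhd; auto; intros x Kx Ux.
    apply NNPP; intro H; apply Hno; eauto. }
  assert (Hp : forall k, exists x, K x /\ ~ U x /\ d s x < / (INR k + 1)).
  { intro k; apply NNPP; intro Hno; apply Hs.
    apply (nbhd_mono _ _ _ _ (nbhd_ball op d s _ Hm Hd (inv_nat_pos k))).
    intros y Hy Ky; apply NNPP; intro H; apply Hno; eauto. }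
  apply choice in Hp; destruct Hp as (p & Hp).
  exists s, p; split; [intros m E; destruct (Hp m) as (_ & ? & _); congruence|].
  intros N HN; apply NNPP; intro Hno.
  assert (Hz : forall k, exists m, (k <= m)%nat /\ ~ N (p m)).
  { intro k; apply NNPP; intro H; apply Hno; exists k; intros m Hkm.
    apply NNPP; intro H'; apply H; eauto. }
  apply choice in Hz; destruct Hz as (z & Hz).
  destruct (compact_cluster op K (fun k => p (z k)) HK) as (c & _ & Hc).
  { intro M; exists M; split; auto; apply Hp. }
  assert (c = s) as ->.
  { apply (cluster_zero_dist op d (fun k => p (z k))); auto; intro k.
    destruct (Hp (z k)) as (_ & _ & H); destruct (Hz k) as (Hkz & _).
    pose proof (inv_nat_anti k (z k) Hkz); lra. }
  destruct (Hc N HN O) as (k & _ & Hk'); apply (Hz k); auto.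
Qed.

Section Free.
Context {X : Type} (op : (X -> Prop) -> Prop) (Htop : is_topology op) (Hty : tychonoff op).
Context (Hk : kspace (A_open op)).
Context (d : FA X -> FA X -> R) (Hm : is_metric d) (Hd : forall U, metric_open d U -> A_open op U).

Lemma fan_contradiction (s : X) (p : nat -> X) (y : nat -> nat -> FA X) :
  (forall m, p m <> s) ->
  (forall N, nbhd op s N -> exists M, forall m, (M <= m)%nat -> N (p m)) ->
  (forall W, nbhd (A_open op) FA_zero W ->
    exists j, forall i, (j <= i)%nat -> forall m, W (y i m)) ->
  (forall i K, compact (A_open op) K -> exists M, forall m, (M <= m)%nat -> ~ K (y i m)) ->
  False.
Proof.
  intros Hne Hp Hy Hesc.
  pose proof (A_open_group op Htop) as Hg; pose proof (proj1 Hg) as Htt.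
  (* The factor [i] makes the rows grow, so that no compact set can meet infinitely many of them,
     while each single row still converges to 0. *)
  set (z := fun i m => FA_mul i (FA_sub (eta (p m)) (eta s))).
  assert (Hz : forall i W, nbhd (A_open op) FA_zero W ->
    exists M, forall m, (M <= m)%nat -> W (z i m)).
  { intros i W HW; apply (Hp (fun x => W (FA_mul i (FA_sub (eta x) (eta s))))).
    apply (admissible_translate op (A_open op) (fun u => W (FA_mul i u))).
    - apply A_open_admissible; auto.
    - apply mul_nbhd; auto.
      replace (FA_mul i FA_zero) with (@FA_zero X); auto.
      clear; induction i as [|i IH]; auto.
      change (FA_zero = FA_add FA_zero (FA_mul i (@FA_zero X))); rewrite <- IH; fa. }
  assert (HY : forall i, compact (A_open op) (fun g => g = FA_zero \/ exists m, g = z i m)).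
  { intro i; apply compact_sequence; auto. }
  set (a := fun i m => FA_add (y i m) (z i m)).
  assert (Hrow : forall L, compact (A_open op) L -> forall i,
    exists M, forall m, (M <= m)%nat -> ~ L (a i m)).
  { intros L HL i; destruct (Hesc i _ (compact_sub _ Hg _ _ HL (HY i))) as (M & HM).
    exists M; intros m Hm' HLa; apply (HM m Hm'); exists (a i m), (z i m).
    repeat split; eauto; unfold a; fa. }
  assert (Hcol : forall L, compact (A_open op) L ->
    exists I, forall i, (I <= i)%nat -> forall m, ~ L (a i m)).
  { intros L HL; apply NNPP; intro Hno.
    (* The square is chosen because the weighted supremum [F] is only known to be at least $1/(k+1)$
       at the chosen point; multiplied by the row index this gives at least [k + 1]. *)
    assert (Hi : forall k, exists im : nat * nat,
      ((k + 1) * (k + 1) <= fst im)%nat /\ L (a (fst im) (snd im))).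
    { intro k; apply NNPP; intro H; apply Hno; exists ((k + 1) * (k + 1))%nat.
      intros i Hi m Lm; apply H; exists (i, m); auto. }
    apply choice in Hi; destruct Hi as (im & Him).
    (* The chosen row indices tend to infinity, so the corresponding [y] converge to 0. Subtracting
       them from [L] leaves a compact set containing the chosen [z], on which [ev F] must be
       bounded. *)
    assert (HP : compact (A_open op)
      (fun g => g = FA_zero \/ exists k, g = y (fst (im k)) (snd (im k)))).
    { apply compact_sequence; intros N HN; destruct (Hy N HN) as (j & Hj).
      exists j; intros k Hjk; apply Hj; destruct (Him k); nia. }
    assert (Hf : forall k, exists f, Rcont op f /\ (forall x, 0 <= f x <= 1) /\
      f (p (snd (im k))) = 1 /\ f s = 0).
    { intro k; destruct (proj1 Hty _ _ (Hne (snd (im k)))) as (V & HV & Vp & Vs).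
      destruct (bump op Hty _ V (nbhd_open _ _ _ HV Vp)) as (f & ? & ? & ? & ?).
      exists f; auto. }
    apply choice in Hf; destruct Hf as (f & Hf).
    destruct (Rcont_weighted_sup op f) as (F & HF & HFf & HF0); auto.
    { intro; apply Hf. }
    { intro; apply Hf. }
    destruct (compact_bounded _ _ (ev F) (compact_sub _ Hg _ _ HL HP)) as (B & HB).
    { intro; apply ev_continuous; auto; lra. }
    destruct (archimed B) as (HB' & _).
    set (k := Z.to_nat (up B)).
    assert (Hk' : B < INR k + 1).
    { unfold k; destruct (Z.le_gt_cases 0 (up B)).
      - rewrite INR_IZR_INZ, Z2Nat.id; lra || auto.
      - assert (IZR (up B) < 0) by (apply IZR_lt; lia).
        pose proof (pos_INR (Z.to_nat (up B))); lra. }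
    destruct (Him k) as (Hik & HLk).
    specialize (HB (z (fst (im k)) (snd (im k)))).
    assert (HBk : INR (fst (im k)) * (F (p (snd (im k))) - F s) <= B).
    { rewrite <- !(ev_eta F), <- ev_sub, <- ev_mul; apply HB.
      exists (a (fst (im k)) (snd (im k))), (y (fst (im k)) (snd (im k))).
      repeat split; eauto; unfold a; fa. }
    rewrite (HF0 s) in HBk by (intro; apply Hf).
    specialize (HFf k (p (snd (im k)))).
    destruct (Hf k) as (_ & _ & H1 & _); rewrite H1 in HFf.
    apply le_INR in Hik; rewrite mult_INR, plus_INR in Hik; simpl in Hik.
    pose proof (pos_INR k) as Hkp; set (c := INR k + 1) in *.
    assert (Hc : 0 < c) by (unfold c; lra).
    assert (Hci : 0 < / c) by (apply Rinv_0_lt_compat; auto).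
    assert (c <= INR (fst (im k)) * (F (p (snd (im k))) - 0)); [|lra].
    replace c with (c * c * (1 * / c)) by (field; lra).
    rewrite Rminus_0_r; apply Rmult_le_compat; auto; nra. }
  assert (HA : A_open op (fun g => ~ (g <> FA_zero /\ exists i m, g = a i m))).
  { apply Hk; intros L HL.
    destruct (Hcol L HL) as (I & HI).
    pose proof (Hrow L HL) as HM; apply choice in HM; destruct HM as (M & HM).
    (* A finite list containing every [a i m] in [L]; points of a finite set can be avoided by the
       T1 axiom. *)
    set (l := flat_map (fun i => map (a i) (seq 0 (M i))) (seq 0 I)).
    assert (Hl : forall i m, L (a i m) -> In (a i m) l).
    { intros i m HLa; apply in_flat_map; exists i; split.
      - apply in_seq; destruct (le_lt_dec I i); [exfalso; eapply HI; eauto | lia].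
      - apply in_map, in_seq; destruct (le_lt_dec (M i) m); [exfalso; eapply HM; eauto | lia]. }
    apply rel_open_of_nbhd; auto; intros g Lg HAg.
    apply (nbhd_mono _ _ _ _
      (nbhd_avoid_list _ g l Htt (T1_of_metric _ d Hm Hd))).
    intros h Hh Lh (Hh0 & i & m & ->); apply HAg.
    rewrite <- (Hh (Hl i m Lh)); split; eauto. }
  (* Near 0 some [a j m] must then equal 0, so that [y j m] is the negative of [z j m]; but row [j]
     of [y] leaves the compact set of these negatives. *)
  destruct (half_nbhd _ Hg _ (nbhd_open _ FA_zero _ HA (fun H => proj1 H eq_refl)))
    as (N & HN & HNA).
  destruct (Hy N HN) as (j & Hj); destruct (Hz j N HN) as (M & HM).
  destruct (Hesc j _ (compact_sub _ Hg _ _ (compact_point _ FA_zero) (HY j))) as (M' & HM').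
  specialize (HM (Nat.max M M') ltac:(lia)); specialize (HM' (Nat.max M M') ltac:(lia)).
  specialize (HNA _ _ (Hj j (le_n j) (Nat.max M M')) HM).
  assert (E : a j (Nat.max M M') = FA_zero).
  { apply NNPP; intro H; apply HNA; split; [exact H | exists j, (Nat.max M M'); reflexivity]. }
  apply HM'; exists FA_zero, (z j (Nat.max M M')); repeat split; eauto.
  rewrite <- E; unfold a; fa.
Qed.

(** * Relatively compact intersections of the sets $D_t$ and the exhaustion of $X$ *)

Context (U : (nat -> nat) -> FA X -> Prop).
Context (HUn : forall a, nbhd (A_open op) FA_zero (U a)).
Context (HUc : forall V, nbhd (A_open op) FA_zero V -> exists a, forall y, U a y -> V y).
Context (HUa : forall a b : nat -> nat, (forall n, (a n <= b n)%nat) ->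
  forall y, U b y -> U a y).

(** The set $D_t$ for the finite sequence [t]. *)
Definition core (t : list nat) (g : FA X) : Prop := forall b, extends t b -> U b g.

Definition cores (e : list (list nat)) (g : FA X) : Prop := forall t, In t e -> core t g.

(** Otherwise there are points of [K] tending to 0, the [k]-th outside [U b] for some [b] extending
    [prefix a k]. One sequence [c] dominates all these [b], and the points cluster at 0, so one of
    them lies in [U c] and hence in its [U b]. *)
Lemma core_prefix_trace K a : compact (A_open op) K ->
  exists k, nbhd (A_open op) FA_zero (fun g => K g -> core (prefix a k) g).
Proof.
  intro HK; apply NNPP; intro Hno.
  assert (H : forall k, exists gb : FA X * (nat -> nat), K (fst gb) /\
    d FA_zero (fst gb) < / (INR k + 1) /\ extends (prefix a k) (snd gb) /\
    ~ U (snd gb) (fst gb)).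
  { intro k; apply NNPP; intro Hk'; apply Hno; exists k.
    apply (nbhd_mono _ _ _ _ (nbhd_ball _ d FA_zero _ Hm Hd (inv_nat_pos k))).
    intros g Hg Kg b Hb; apply NNPP; intro HU; apply Hk'; exists (g, b); auto. }
  apply choice in H; destruct H as (gb & H).
  destruct (diagonal_bound a (fun k => snd (gb k))) as (c & _ & Hc).
  { intro k; apply extends_prefix; apply H. }
  destruct (compact_cluster _ K (fun k => fst (gb k)) HK) as (g & _ & Hcl).
  { intro M; exists M; split; auto; apply H. }
  assert (g = FA_zero) as ->.
  { apply (cluster_zero_dist (A_open op) d (fun k => fst (gb k))); auto; intro; apply H. }
  destruct (Hcl _ (HUn c) O) as (k & _ & Hk').
  apply (H k); revert Hk'; apply HUa; auto.
Qed.

(** If no [e] works, each [cores (es i)] contains a sequence that leaves every compact set. These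
    rows converge to 0 uniformly because every [U a] contains some $D_t$ listed in [es], which
    yields the forbidden fan. *)
Lemma compact_core_trace : ~ discrete op -> forall K, compact (A_open op) K -> exists e,
  (exists L, compact (A_open op) L /\ forall g, cores e g -> L g) /\
  nbhd (A_open op) FA_zero (fun g => K g -> cores e g).
Proof.
  intros Hnd K HK; pose proof (A_open_group op Htop) as Hg; pose proof (proj1 Hg) as Htt.
  destruct (convergent_sequence op) as (s & p & Hne & Hp); auto.
  { apply kspace_of_free; auto. }
  { apply submetrizable_of_free; auto; exists d; auto. }
  apply NNPP; intro Hno.
  destruct (countable_list nat countable_nat) as (enum & Henum).
  set (P := fun t => nbhd (A_open op) FA_zero (fun g => K g -> core t g)).
  (* [S i] makes the sequence numbered [j] available from row [j] on. *)
  set (es := fun i => filter (fun t => if excluded_middle_informative (P t) then true else false)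
    (prefix enum (S i))).
  assert (HP : forall i t, In t (es i) -> P t).
  { intros i t Ht; apply filter_In in Ht; destruct Ht as (_ & Ht).
    destruct (excluded_middle_informative (P t)); auto; discriminate. }
  assert (Hes : forall i, nbhd (A_open op) FA_zero (fun g => K g -> cores (es i) g)).
  { intro i; specialize (HP i); induction (es i) as [|t l IH].
    - apply (nbhd_mono _ _ (fun _ => True)); [apply nbhd_true; auto|].
      intros g _ _ t [].
    - apply (nbhd_mono _ _ _ _ (nbhd_and _ _ _ _ Htt (HP t (or_introl eq_refl))
        (IH (fun t Ht => HP t (or_intror Ht))))).
      intros g (H1 & H2) Kg t' [<-|Ht]; [apply H1 | apply H2]; auto. }
  assert (Hrow : forall i, exists x : nat -> FA X, (forall n, cores (es i) (x n)) /\
    forall K, compact (A_open op) K -> exists M, forall n, (M <= n)%nat -> ~ K (x n)).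
  { intro i; destruct (compact_closure_or_escape (A_open op) d (cores (es i))) as [Hc|Hc]; auto.
    - apply group_regular; auto.
    - exfalso; apply Hno; exists (es i); split; auto.
      exists (closure (A_open op) (cores (es i))); split; auto.
      intros g; apply subset_closure. }
  apply choice in Hrow; destruct Hrow as (y & Hrow).
  apply (fan_contradiction s p y); auto; [|intro; apply Hrow].
  intros W HW; destruct (HUc W HW) as (a & Ha).
  destruct (core_prefix_trace K a HK) as (k & Hk').
  destruct (Henum (prefix a k) I) as (j & Hj).
  exists j; intros i Hij m; apply Ha; apply (proj1 (Hrow i) m (prefix a k)).
  - apply filter_In; split.
    + rewrite <- Hj; apply in_map, in_seq; lia.
    + destruct (excluded_middle_informative (P (prefix a k))); auto.
  - apply extends_prefix; auto.
Qed.

Lemma k_omega_of_free : ~ discrete op -> separable op -> k_omega op.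
Proof.
  intros Hnd (D & (q & Hq) & HD).
  pose proof (A_open_group op Htop) as Hg; pose proof (proj1 Hg) as Htt.
  (* A compact set around [cores e] when there is one; the empty set is the default. *)
  assert (HL : forall e, exists L, compact (A_open op) L /\
    ((exists L, compact (A_open op) L /\ forall g, cores e g -> L g) ->
      forall g, cores e g -> L g)).
  { intro e; destruct (classic (exists L, compact (A_open op) L /\ forall g, cores e g -> L g))
      as [(L & ? & ?)|H].
    - exists L; auto.
    - exists (fun _ => False); split; [apply compact_empty | tauto]. }
  apply choice in HL; destruct HL as (L & HL).
  set (Lw := fix Lw w := match w with
    | nil => fun g => g = FA_zero
    | e :: w => fun g => exists u v, L e u /\ Lw w v /\ g = FA_add u v
    end).
  assert (HLw : forall w, compact (A_open op) (Lw w)).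
  { induction w as [|e w IH]; simpl; [apply compact_point|].
    apply compact_add; auto; apply HL. }
  assert (Htrace : forall K g, compact (A_open op) K -> exists e,
    nbhd (A_open op) g (fun h => K h -> L e (FA_sub h g))).
  { intros K g HK; apply (compact_translate _ Hg K g) in HK.
    destruct (compact_core_trace Hnd _ HK) as (e & HeL & He); exists e.
    apply (nbhd_mono _ _ _ _ (nbhd_of_zero _ Hg g _ He)); intros h Hh Kh.
    apply HL; auto; apply Hh; rewrite FA_sub_add; auto. }
  (* The k-property makes the submonoid open: near [g], a compact set stays within [g] plus a single
     [L e], and [e] is prepended to the word of [g]. *)
  assert (HH : A_open op (fun g => exists w, Lw w g)).
  { apply Hk; intros K HK; apply rel_open_of_nbhd; auto; intros g Kg (w & Hw).
    destruct (Htrace K g HK) as (e & He); apply (nbhd_mono _ _ _ _ He).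
    intros h Hh Kh; exists (e :: w), (FA_sub h g), g; repeat split; auto; fa. }
  (* The submonoid is a neighborhood of 0, so [x] differs from a close enough point [q j] of the
     dense set by one of its elements. *)
  assert (Hcov : forall x, exists j w, Lw w (FA_add (FA_opp (eta (q j))) (eta x))).
  { intro x; destruct (sub_nbhd _ Hg (eta x) (eta x) (fun g => exists w, Lw w g))
      as (A & B & HA & HB & HAB).
    - apply nbhd_open; auto; exists nil; rewrite FA_sub_self; simpl; auto.
    - apply (continuous_nbhd op (A_open op) eta) in HB; [|apply eta_continuous; auto].
      destruct HB as (V & HV & Vx & HVB); destruct (HD V HV) as (y & Vy & Dy); eauto.
      destruct (Hq y Dy) as (j & <-); exists j.
      replace (FA_add (FA_opp (eta (q j))) (eta x)) with (FA_sub (eta x) (eta (q j))) by fa.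
      apply HAB; auto; exact (nbhd_self _ _ _ HA). }
  destruct (countable_prod nat (list (list (list nat)))) as (enum & Henum);
    [apply countable_nat | repeat apply countable_list; apply countable_nat|].
  (* The trace on [X] of a translate by [eta (q j)]. Finite unions over [i < n] form the exhaustion,
     starting from the empty set. *)
  set (Kx := fun i x => Lw (snd (enum i)) (FA_add (FA_opp (eta (q (fst (enum i))))) (eta x))).
  exists (fun n x => exists i, (i < n)%nat /\ Kx i x); split; [|split; [|split]].
  - induction n as [|n IH].
    + match goal with |- compact _ ?A => rewrite (set_ext A (fun _ => False)) end;
        [apply compact_empty|].
      intro x; split; [intros (i & ? & _); lia | tauto].
    + match goal with |- compact _ ?A =>
        rewrite (set_ext A (fun x => (exists i, (i < n)%nat /\ Kx i x) \/ Kx n x)) end.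
      * apply compact_union; auto.
        apply (compact_eta_preimage op Htop Hty
          (fun g => Lw (snd (enum n)) (FA_add (FA_opp (eta (q (fst (enum n))))) g))).
        apply compact_translate; auto.
      * intro x; split.
        -- intros (i & Hi & Hx); destruct (Nat.eq_dec i n) as [->|]; auto.
           left; exists i; split; auto; lia.
        -- intros [(i & Hi & Hx)|Hx]; [exists i | exists n]; split; auto.
  - intros n x (i & Hi & Hx); exists i; split; auto.
  - intro x; destruct (Hcov x) as (j & w & Hw); destruct (Henum (j, w) I) as (i & Hi).
    exists (S i), i; split; auto; unfold Kx; rewrite Hi; auto.
  (* [X] is a k-space, so traces on compact sets suffice. Near [x] the compact set lies in the
     single piece coded by [e :: w], on which [V] is relatively open. *)
  - intros V HV; apply (kspace_of_free op Htop Hty Hk); intros K HK.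
    apply rel_open_of_nbhd; auto; intros x Kx' Vx.
    destruct (Hcov x) as (j & w & Hw).
    pose proof (compact_image op (A_open op) eta K (eta_continuous op Htop) HK) as HeK.
    destruct (Htrace _ (eta x) HeK) as (e & He).
    apply (continuous_nbhd op (A_open op) eta) in He; [|apply eta_continuous; auto].
    destruct (Henum (j, e :: w) I) as (i & Hi).
    assert (HKi : nbhd op x (fun y => K y -> Kx i y)).
    { apply (nbhd_mono _ _ _ _ He); intros y Hy Ky; unfold Kx; rewrite Hi; simpl.
      exists (FA_sub (eta y) (eta x)), (FA_add (FA_opp (eta (q j))) (eta x)).
      repeat split; eauto; fa. }
    pose proof (rel_open_nbhd _ _ _ x (HV (S i))
      (ex_intro _ i (conj (le_n (S i)) (nbhd_self _ _ _ HKi Kx'))) Vx) as HVx.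
    apply (nbhd_mono _ _ _ _ (nbhd_and _ _ _ _ Htop HKi HVx)).
    intros y (Hy & HyV) Ky; apply HyV; eauto.
Qed.

End Free.

Theorem theorem4p6 (X : Type) (op : (X -> Prop) -> Prop)
  (Htop : is_topology op) (Hty : tychonoff op) (Hsep : separable op) :
  (kspace (A_open op) /\ has_Gbase (A_open op)) <->
  ((countable_type X /\ discrete op) \/ (submetrizable op /\ k_omega op)).
Proof.
  split.
  - intros (Hk & HG).
    destruct (classic (discrete op)) as [Hdis|Hnd]; [left; split; auto | right].
    + destruct Hsep as (D & (q & Hq) & HD); exists q; intros x _; apply Hq.
      destruct (HD (fun y => y = x) (Hdis _)) as (y & -> & Dy); eauto.
    + destruct (HG FA_zero) as (U & HUn & HUc & HUa).
      assert (HUc' : forall V, nbhd (A_open op) FA_zero V -> exists a, forall y, U a y -> V y).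
      { intros V (V' & HV' & V0 & HVV); destruct (HUc V' HV' V0) as (a & Ha); eauto. }
      destruct (free_submetrizable op Htop Hty U HUn HUc' HUa Hsep) as (d & Hm & Hd).
      split.
      * apply submetrizable_of_free; auto; exists d; auto.
      * apply (k_omega_of_free op Htop Hty Hk d Hm Hd U HUn HUc' HUa); auto.
  - intros [(_ & Hdis)|((d & Hm & Hd) & (K & HK & Hinc & Hcov & Hdet))].
    + split; [intros W _; apply discrete_A_open; auto|].
      (* Points are open, so the constant family consisting of the singleton is a G-base. *)
      intro g; exists (fun _ h => h = g); split; [|split]; auto.
      * intros _; exists (fun h => h = g); repeat split; auto; apply discrete_A_open; auto.
      * intros V _ Vg; exists (fun _ => O); intros h ->; auto.
    + split.
      * apply (k_omega_kspace op Htop d Hm Hd K); auto.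
      * apply (k_omega_Gbase op Htop d Hm Hd K); auto.
Qed.
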